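(* Let $(\Sigma,\sigma)$ be a transitive countable Markov shift with alphabet $\mathbb{N}$, let $\tau:\Sigma\to(0,\infty)$ be a roof function bounded away from zero and with summable variations, and let $(Y,\Phi)$ be the associated suspension flow. Let $f:Y\to\mathbb{R}$ be a continuous function such that $\sup f<\infty$, $\Delta_f$ has summable variations and $P^\Phi(f)<\infty$. Assume that $(\nu_n)_n$ is a sequence in $\mathcal M_\Phi$ such that $\liminf_{n\to\infty}\int f\,d\nu_n>-\infty$. Then $(\nu_n)_n$ has a subsequence that converges on cylinders (to some measure in $\mathcal M_{\le1}(\Phi)$).
   Context: Countable Markov shift: given a matrix $A=(A(i,j))_{i,j\in\mathbb{N}}$ with entries in $\{0,1\}$, let $\Sigma=\{(x_1,x_2,\dots)\in\mathbb{N}^{\mathbb{N}}:A(x_i,x_{i+1})=1\ \forall i\}$ with the topology induced by the product of discrete topologies, and $\sigma(x_1,x_2,\dots)=(x_2,x_3,\dots)$. A word $a_1\dots a_N$ is admissible if $A(a_i,a_{i+1})=1$ for all $i<N$; the cylinder $[a_1,\dots,a_N]$ is the set of $x\in\Sigma$ with $x_i=a_i$ for $i\le N$. $(\Sigma,\sigma)$ is transitive if for all $a,b\in\mathbb{N}$ there is an admissible word starting with $a$ and ending with $b$. Variations: $V_n(\phi)=\sup\{|\phi(x)-\phi(y)|:x_i=y_i,\ 1\le i\le n\}$; $\phi$ has summable variations if $\sum_{n=2}^\infty V_n(\phi)<\infty$. Suspension (semi)flow: for $\tau$ continuous, positive and bounded away from zero, $Y=\{(x,t)\in\Sigma\times\mathbb{R}:0\le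 t\le\tau(x)\}/\sim$ with $(x,\tau(x))\sim(\sigma(x),0)$, and $\Phi_t(x,s)=(x,s+t)$ whenever $s+t\in[0,\tau(x)]$, extended to all $t\ge0$ through the identification. $Y_0=\{(x,t)\in\Sigma\times\mathbb{R}:0\le t<\tau(x)\}$ is identified with $Y$. $\mathcal M_\Phi$ (resp. $\mathcal M_{\le1}(\Phi)$) is the set of $\Phi$-invariant Borel probability (resp. sub-probability) measures on $Y$. For continuous $g:Y\to\mathbb{R}$, $\Delta_g(x)=\int_0^{\tau(x)}g(x,t)\,dt$. Convergence on cylinders: $(\nu_n)_n$ converges on cylinders to $\nu'\in\mathcal M_{\le1}(\Phi)$ if $\nu_n((C\times[a,b])\cap Y_0)\to\nu'((C\times[a,b])\cap Y_0)$ for every cylinder $C\subset\Sigma$ and all $a,b\in\mathbb{R}$. Pressure: for $a\in\mathbb{N}$, $T_1\le T_2$ let $\mathrm{FPer}_a(T_1,T_2)=\{(x;s)\in[a]\times[T_1,T_2]:\Phi_s(x,0)=(x,0)\}$, and $$P^\Phi(g)=\limsup_{T\to\infty}\frac1T\log\sum_{(x;s)\in\mathrm{FPer}_a(T-d_1,T+d_2)}\exp\left(\int_0^s g(\Phi_t(x,0))\,dt\right),$$ which does not depend on $a$, $d_1>0$, $d_2\ge0$, and equals $\sup\{h_\nu(\Phi)+\int g\,d\nu:\nu\in\mathcal M_\Phi,\int g\,d\nu>-\infty\}$, where $h_\nu(\Phi)$ is the entropy of the time-one map. *)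

(* Defs.v *)
(* MathComp-Analysis development over an arbitrary [R : realType].
   Sequences are indexed from 0, so the coordinate x_(i+1) of a point of the
   shift is [val x i]. *)
From HB Require Import structures.
From Stdlib Require Import Relation_Operators Operators_Properties.
From mathcomp Require Import all_boot all_order all_algebra generic_quotient.
From mathcomp Require Import all_classical all_reals all_analysis.
Set Implicit Arguments.
Unset Strict Implicit.
Unset Printing Implicit Defensive.
Import Order.TTheory GRing.Theory Num.Theory.
Import numFieldNormedType.Exports.
Local Open Scope classical_set_scope.
Local Open Scope ring_scope.
Local Open Scope quotient_scope.

(* A one-letter word is admissible, so [w] may be empty when [a = b]; since
   [a] and [b] range over all of [nat] this does not weaken transitivity. *)
Definition transitive_matrix (A : nat -> nat -> bool) :=
  forall a b : nat, exists w : seq nat, path A a w && (last a w == b).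

Record transition := Transition {
  adj :> nat -> nat -> bool;
  adj_transitive : transitive_matrix adj }.

Section Shift.
Variable A : transition.

Definition shift_space : set {ptws nat -> nat} :=
  [set x | forall i, A (x i) (x i.+1)].

Definition Sigma : Type := set_type shift_space.

HB.instance Definition _ := Topological.copy Sigma (set_type shift_space).
HB.instance Definition _ := SubType.copy Sigma (set_type shift_space).

Lemma SigmaP (x : Sigma) i : A (val x i) (val x i.+1).
Proof. exact: (set_valP x). Qed.

Lemma Sigma_inhabited : exists x : nat -> nat, shift_space x.
Proof.
have next a : exists b, A a b.
  have [[|b w] /andP[]] := adj_transitive A a a.+1.
    by move=> _ /= /eqP /n_Sn.
  by move=> /= /andP[Aab _] _; exists b.
pose nxt a := sval (cid (next a)).
exists (fun n => iter n nxt 0%N) => i /=.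
exact: (svalP (cid (next _))).
Qed.

Definition Sigma_point : Sigma :=
  SigSub (mem_set (svalP (cid Sigma_inhabited))).

HB.instance Definition _ := isPointed.Build Sigma Sigma_point.

Lemma sigma_subproof (x : Sigma) : shift_space (fun i => val x i.+1).
Proof. by move=> i; exact: SigmaP. Qed.

Definition sigma (x : Sigma) : Sigma := SigSub (mem_set (sigma_subproof x)).

Definition cylinder (w : seq nat) : set Sigma :=
  [set x | forall i, (i < size w)%N -> val x i = nth 0%N w i].

Definition agree (n : nat) (x y : Sigma) :=
  forall i, (i < n)%N -> val x i = val y i.

Variable R : realType.

Definition variation (n : nat) (phi : Sigma -> R) : \bar R :=
  ereal_sup [set (`|phi p.1 - phi p.2|)%:E | p in [set p | agree n p.1 p.2]].

Definition summable_variations (phi : Sigma -> R) :=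
  (\sum_(2 <= n <oo) variation n phi < +oo)%E.

Record roof := Roof {
  roof_fun :> Sigma -> R;
  roof_continuous : continuous roof_fun;
  roof_gt0 : forall x, 0 < roof_fun x;
  roof_bounded_away : exists2 c : R, 0 < c & forall x, c <= roof_fun x }.

End Shift.

Section Suspension.
Variables (A : transition) (R : realType) (tau : roof A R).

(* The space {(x,t) : 0 <= t <= tau x} before identification, with the topology
   induced by Sigma * R. *)
Definition susp_dom : set (Sigma A * R) := [set p | 0 <= p.2 <= tau p.1].

Definition presusp : Type := set_type susp_dom.

HB.instance Definition _ := Topological.copy presusp (set_type susp_dom).
HB.instance Definition _ := SubType.copy presusp (set_type susp_dom).

Lemma susp_dom0 (x : Sigma A) : susp_dom (x, 0).
Proof. by rewrite /susp_dom /= lexx ltW// roof_gt0. Qed.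

Definition susp_base (x : Sigma A) : presusp := SigSub (mem_set (susp_dom0 x)).

HB.instance Definition _ := isPointed.Build presusp (susp_base point).

Definition roof_glue (p q : presusp) : Prop :=
  (val p).2 = tau (val p).1 /\ val q = (sigma (val p).1, 0).

Definition susp_rel : rel presusp :=
  fun p q => `[< clos_refl_sym_trans _ roof_glue p q >].

Lemma susp_rel_refl : reflexive susp_rel.
Proof. by move=> p; apply/asboolP; exact: rst_refl. Qed.

Lemma susp_rel_sym : symmetric susp_rel.
Proof.
by move=> p q; apply/asboolP/asboolP; exact: rst_sym.
Qed.

Lemma susp_rel_trans : transitive susp_rel.
Proof.
move=> q p r /asboolP pq /asboolP qr.
by apply/asboolP; exact: rst_trans pq qr.
Qed.

Canonical susp_equiv := EquivRel susp_rel
  susp_rel_refl susp_rel_sym susp_rel_trans.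

Definition suspension : Type := quotient_topology {eq_quot susp_equiv}.

HB.instance Definition _ :=
  Topological.copy suspension (quotient_topology {eq_quot susp_equiv}).
HB.instance Definition _ :=
  Pointed.copy suspension (quotient_topology {eq_quot susp_equiv}).

(* The class of (x, t) when 0 <= t <= tau x, and of (x, 0) otherwise. *)
Definition susp_pt (x : Sigma A) (t : R) : suspension :=
  \pi_({eq_quot susp_equiv}) (insubd (susp_base x) (x, t)).

Definition borel_suspension := g_sigma_algebraType (@open suspension).

Definition birkhoff (n : nat) (x : Sigma A) : R :=
  \sum_(i < n) tau (iter i (@sigma A) x).

(* For t >= 0, flowing n times through the roof sends (x, s) to
   (sigma^n x, s + t - S_n tau x).  The identification makes the target
   independent of the choice of (x, s) and n. *)
Definition flow_to (t : R) (y z : suspension) : Prop :=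
  exists (x : Sigma A) (s : R) (n : nat),
    let s' := s + t - birkhoff n x in
    [/\ 0 <= s <= tau x, y = susp_pt x s,
        0 <= s' <= tau (iter n (@sigma A) x)
      & z = susp_pt (iter n (@sigma A) x) s'].

(* The semiflow; only its values at times t >= 0 are meaningful. *)
Definition flow (t : R) (y : suspension) : suspension := xget y (flow_to t y).

Definition flow_invariant (mu : set borel_suspension -> \bar R) :=
  forall t : R, 0 <= t ->
  forall B : set borel_suspension, measurable B -> mu (flow t @^-1` B) = mu B.

Definition Delta (g : suspension -> R) (x : Sigma A) : R :=
  \int[lebesgue_measure]_(t in `[0, tau x]) g (susp_pt x t).

(* (C x [a, b]) /\ Y_0 as a subset of suspension. *)
Definition box (C : set (Sigma A)) (a b : R) : set borel_suspension :=
  [set y | exists (x : Sigma A) (t : R),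
    [/\ C x, a <= t <= b, 0 <= t < tau x & y = susp_pt x t]].

(* Cylinders are given by nonempty words: the empty word would give C = Sigma. *)
Definition converges_on_cylinders (nu : nat -> set borel_suspension -> \bar R)
    (nu' : set borel_suspension -> \bar R) :=
  forall (w : seq nat) (a b : R), w <> [::] ->
    nu n (box (cylinder w) a b) @[n --> \oo] --> nu' (box (cylinder w) a b).

Definition FPer (a : nat) (T1 T2 : R) : set (Sigma A * R) :=
  [set xs | [/\ cylinder [:: a] xs.1, 0 <= xs.2, T1 <= xs.2 <= T2
              & flow xs.2 (susp_pt xs.1 0) = susp_pt xs.1 0]].

Definition pressure (a : nat) (d1 d2 : R) (g : suspension -> R) : \bar R :=
  limf_esup (fun T : R => ((T^-1)%:E *
    lne (\esum_(xs in FPer a (T - d1) (T + d2))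
      (expR (\int[lebesgue_measure]_(t in `[0, xs.2])
         g (flow t (susp_pt xs.1 0))))%:E))%E) (pinfty_nbhs R).

End Suspension.

(* Main.v *)
(** An invariant probability measure on the suspension disintegrates as [m \x lambda]
    under the roof, where [m] is a finite shift-invariant measure on the shift.  Put
    [G = M tau - Delta f] with [M] a bound of [f] plus one, so that [G >= tau > 0]; the
    bound on the integrals of [f] bounds the integrals of [G].  A loop at the symbol [i]
    whose total [G]-cost is at most [N] can be completed, by bounded distortion, into a
    periodic orbit which contributes at least a fixed amount to one of finitely many sums
    defining the pressure; since these sums are finite, only finitely many symbols can
    follow [i] in such loops.  Hence successive visits to the set of points [i j ...]
    with [j] large are expensive, and as the mean cost is bounded these sets have small
    mass, uniformly along the sequence.  Along a subsequence the masses of all cylinders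
    converge (Tychonoff).  By the previous tightness the limit weight of a nonempty word
    is the sum of the limit weights of its children, so the limit weights define a finite
    measure on the shift; it is invariant, and its suspension is the limit measure. *)
From HB Require Import structures.
Require Import Defs.
From Stdlib Require Import Relation_Operators Operators_Properties.
From mathcomp Require Import finmap all_boot all_order all_algebra generic_quotient.
From mathcomp Require Import all_classical all_reals all_analysis.
From mathcomp Require Import measurable_realfun ring lra.
Set Implicit Arguments.
Unset Strict Implicit.
Unset Printing Implicit Defensive.
Import Order.TTheory GRing.Theory Num.Theory.
Import numFieldNormedType.Exports.
Local Open Scope classical_set_scope.
Local Open Scope ring_scope.

(** The alphabet is infinite, so a limit of cylinder masses need not be additive: mass can escape to
    infinity in the alphabet. Finite pressure excludes an escape after a given symbol, but nothing
    prevents the first symbol itself from escaping. This is why only nonempty words have controlled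
    weights and why the limit may lose mass. One cost [G] serves two purposes. As [G] dominates
    [tau], a cheap loop takes bounded time; as [M] is nonnegative, the sum of [Delta f] along the
    loop, which is [M] times that time minus the cost, is bounded below. The former puts the periods
    into finitely many windows, the latter bounds their weights from below. The preimage of a
    cylinder under the shift is an infinite union of cylinders, so invariance does not pass to the
    limit term by term. Convergence on boxes is also more than convergence on cylinders of the base:
    the mass of a box is the integral of the length cut out of each fiber, and the summable
    variations of [tau] make this length uniformly continuous. *)

(** * Cylinders and the topology of the shift *)

Section ShiftFacts.
Variable A : transition.
Implicit Types x y : Sigma A.

Lemma iter_sigmaE n x i : val (iter n (@sigma A) x) i = val x (n + i)%N.
Proof.
elim: n i => [|n IH] i //=.
by rewrite IH addnS addSn.
Qed.

Lemma Sigma_ext x y : (forall i, val x i = val y i) -> x = y.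
Proof. by move=> xy; apply/val_inj/funext. Qed.

Lemma agree_le n k x y : (n <= k)%N -> agree k x y -> agree n x y.
Proof. by move=> nk xy i ilt; apply: xy; exact: leq_trans nk. Qed.

Lemma cylinder_agree w x y :
  cylinder w x -> cylinder w y -> agree (size w) x y.
Proof. by move=> wx wy i ilt; rewrite wx// wy. Qed.

Lemma cylinder_mkseq x n y : cylinder (mkseq (val x) n) y <-> agree n x y.
Proof.
rewrite /cylinder /agree /= size_mkseq; split=> h i ilt.
  by rewrite h// nth_mkseq.
by rewrite nth_mkseq// -h.
Qed.

Lemma cylinder_self x n : cylinder (mkseq (val x) n) x.
Proof. exact/cylinder_mkseq. Qed.

Lemma cylinder_nil : cylinder [::] = [set: Sigma A].
Proof. by apply/seteqP; split. Qed.

Lemma cylinder_rcons w j x :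
  cylinder (rcons w j) x <-> cylinder w x /\ val x (size w) = j.
Proof.
rewrite /cylinder /= size_rcons; split=> [h|[h1 h2] i].
  split; first by move=> i ilt; rewrite h ?leqW// nth_rcons ilt.
  by rewrite h// nth_rcons ltnn eqxx.
rewrite ltnS leq_eqVlt nth_rcons => /predU1P[->|ilt].
  by rewrite ltnn eqxx.
by rewrite ilt h1.
Qed.

Lemma cylinder_split w : cylinder w = \bigcup_j (@cylinder A (rcons w j)).
Proof.
apply/seteqP; split=> [x wx|x [j _] /cylinder_rcons[]//].
by exists (val x (size w)) => //; apply/cylinder_rcons.
Qed.

Lemma trivIset_cylinder w : trivIset setT (fun j => @cylinder A (rcons w j)).
Proof.
move=> i j _ _ [x [/cylinder_rcons[_ <-] /cylinder_rcons[_ <-]]] //.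
Qed.

Lemma val_continuous (i : nat) : continuous (fun x : Sigma A => val x i).
Proof.
move=> x; apply: (@continuous_comp _ _ _
  (fun y => val y : {ptws nat -> nat}) (fun f : {ptws nat -> nat} => f i)).
  exact: (@initial_continuous (Sigma A) _ (fun y => val y : {ptws nat -> nat})).
exact: (@proj_continuous nat (fun=> nat) i).
Qed.

Lemma open_coord (i : nat) (P : set nat) : open [set x : Sigma A | P (val x i)].
Proof.
have /continuousP := @val_continuous i.
by apply; exact: discrete_open.
Qed.

Lemma open_cylinder w : open (@cylinder A w).
Proof.
elim/last_ind: w => [|w j IH]; first by rewrite cylinder_nil; exact: openT.
rewrite (_ : cylinder _ =
    cylinder w `&` [set x | [set j] (val x (size w))]); last first.
  by apply/seteqP; split=> x /cylinder_rcons.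
by apply: openI => //; exact: open_coord.
Qed.

Lemma closed_cylinder w : closed (@cylinder A w).
Proof.
elim/last_ind: w => [|w j IH]; first by rewrite cylinder_nil; exact: closedT.
rewrite (_ : cylinder _ =
    cylinder w `&` ~` [set x | [set~ j] (val x (size w))]); last first.
  apply/seteqP; split=> x; first by move=> /cylinder_rcons[h1 h2]; split => // /(_ h2).
  by move=> [h1 /= h2]; apply/cylinder_rcons; split => //; exact: contrapT.
by apply: closedI => //; apply: open_closedC; exact: open_coord.
Qed.

(** Cylinders form a neighbourhood basis: points outside [U] agreeing with [x] on ever longer
    prefixes would converge to [x] pointwise. *)
Lemma open_agree (U : set (Sigma A)) x : open U -> U x ->
  exists k, forall y, agree k x y -> U y.
Proof.
move=> oU Ux; apply: contrapT => /forallNP no.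
have /choice[y yP] : forall k, exists y, agree k x y /\ ~ U y.
  by move=> k; have /existsNP[y /not_implyP[]] := no k; exists y.
have [V oV VU] : exists2 V : set {ptws nat -> nat}, open V &
    (fun z : Sigma A => val z : {ptws nat -> nat}) @^-1` V = U by exact: oU.
have cv : (fun k => val (y k) : {ptws nat -> nat}) @ \oo -->
    (val x : {ptws nat -> nat}).
  apply/pointwise_cvgP => t.
  suff : (fun k => val (y k) t) @ \oo --> val x t by [].
  apply: cvg_near_cst; near=> k => /=.
  by rewrite -(yP k).1//; near: k; exact: nbhs_infty_gt.
have : nbhs (val x : {ptws nat -> nat}) V.
  by apply: open_nbhs_nbhs; split => //; rewrite -VU in Ux.
move=> /cv [N _ /(_ N (leqnn N))] /= VN.
by apply: (yP N).2; rewrite -VU.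
Unshelve. all: by end_near. Qed.

Lemma sigma_continuous : continuous (@sigma A).
Proof.
apply/continuousP => U oU; rewrite openE => x /= Ux.
have [k kU] := open_agree oU Ux.
apply: (@filterS _ _ _ (cylinder (mkseq (val x) k.+1))).
  move=> y /cylinder_mkseq xy; apply: kU => i ik /=; exact: xy.
by apply: open_nbhs_nbhs; split; [exact: open_cylinder|exact: cylinder_self].
Qed.

End ShiftFacts.

(** * Coordinates and orbits in the suspension *)

Section FlowFacts.
Variables (A : transition) (R : realType) (tau : roof A R).
Implicit Types (x : Sigma A) (t s : R) (y z : suspension tau).
Local Notation sigma := (@sigma A).
Local Open Scope quotient_scope.

(* The representative of the class of [p] which lies strictly below the roof. *)
Definition norm_pt (p : presusp tau) : Sigma A * R :=
  if (val p).2 < tau (val p).1 then val p else (sigma (val p).1, 0).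

(** Gluing does not cascade: the roof is positive, so [(sigma x, 0)] already lies strictly below its
    own roof, and [norm_pt] is constant along each generating step. *)
Lemma norm_pt_rel p q : susp_rel p q -> norm_pt p = norm_pt q.
Proof.
move=> /asboolP; elim=> {p q} [p q [p2 qE]|//|p q _ ->//|p q r _ -> _ ->//].
by rewrite /norm_pt p2 ltxx qE /= roof_gt0.
Qed.

Definition coords y : Sigma A * R := norm_pt (repr y).

Lemma coords_pi p : coords (\pi_({eq_quot (susp_equiv tau)}) p) = norm_pt p.
Proof. by apply: norm_pt_rel; apply/eqmodP; rewrite reprK. Qed.

Lemma coords_lt x t : 0 <= t < tau x -> coords (susp_pt tau x t) = (x, t).
Proof.
move=> /andP[t0 tt]; have d : susp_dom tau (x, t) by rewrite /susp_dom/= t0 ltW.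
rewrite /susp_pt coords_pi /norm_pt val_insubd (_ : (x, t) \in _)//=.
  by rewrite tt.
exact/mem_set.
Qed.

Lemma coords_top x : coords (susp_pt tau x (tau x)) = (sigma x, 0).
Proof.
have d : susp_dom tau (x, tau x) by rewrite /susp_dom/= lexx ltW// roof_gt0.
rewrite /susp_pt coords_pi /norm_pt val_insubd (_ : (x, _) \in _)//=.
  by rewrite ltxx.
exact/mem_set.
Qed.

Lemma susp_pt_top x : susp_pt tau x (tau x) = susp_pt tau (sigma x) 0.
Proof.
have d : susp_dom tau (x, tau x) by rewrite /susp_dom/= lexx ltW// roof_gt0.
have d' : susp_dom tau (sigma x, 0) by exact: susp_dom0.
apply/eqmodP; apply/asboolP; apply: rst_step.
by rewrite /roof_glue !val_insubd (mem_set d : _ \in _) (mem_set d' : _ \in _).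
Qed.

Definition Y0 : set (Sigma A * R) := [set p | 0 <= p.2 < tau p.1].

Definition pt (p : Sigma A * R) : suspension tau := susp_pt tau p.1 p.2.

Lemma coordsP y : Y0 (coords y) /\ pt (coords y) = y.
Proof.
rewrite /coords /norm_pt; set p := repr y.
have /andP[p0 pt'] : 0 <= (val p).2 <= tau (val p).1.
  exact: (set_mem (valP p) : susp_dom tau (val p)).
have Ep : susp_pt tau (val p).1 (val p).2 = y.
  rewrite /susp_pt -surjective_pairing /insubd valK /=; exact: reprK.
case: ifPn => [lt|]; first by rewrite /Y0 /= p0.
rewrite -leNgt => le; split; first by rewrite /Y0 /= lexx roof_gt0.
have E : (val p).2 = tau (val p).1 by apply/eqP; rewrite eq_le pt'.
by rewrite /pt /= -susp_pt_top -E.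
Qed.

Lemma coordsK : cancel coords pt.
Proof. by move=> y; have [] := coordsP y. Qed.

Lemma coords_Y0 y : Y0 (coords y).
Proof. by have [] := coordsP y. Qed.

Lemma ptK p : Y0 p -> coords (pt p) = p.
Proof. by case: p => x t; exact: coords_lt. Qed.

Lemma birkhoffS n x : birkhoff tau n.+1 x = tau x + birkhoff tau n (sigma x).
Proof.
rewrite /birkhoff big_ord_recl /=; congr (_ + _); apply: eq_bigr => i _.
by rewrite -iterS iterSr.
Qed.

Lemma birkhoffSr n x :
  birkhoff tau n.+1 x = birkhoff tau n x + tau (iter n sigma x).
Proof. by rewrite /birkhoff big_ord_recr. Qed.

Lemma birkhoff0 x : birkhoff tau 0 x = 0.
Proof. by rewrite /birkhoff big_ord0. Qed.

Lemma birkhoff_ltS n x : birkhoff tau n x < birkhoff tau n.+1 x.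
Proof. by rewrite birkhoffSr ltrDl roof_gt0. Qed.

Lemma birkhoff_le m n x : (m <= n)%N -> birkhoff tau m x <= birkhoff tau n x.
Proof.
move=> mn; rewrite -(subnK mn); elim: (n - m)%N => [|k IH]; first by rewrite add0n.
by apply: (le_trans IH); rewrite addSn ltW// birkhoff_ltS.
Qed.

Lemma birkhoff_ge (c : R) n x : (forall u, c <= tau u) ->
  c *+ n <= birkhoff tau n x.
Proof.
move=> hc; elim: n => [|n IH]; first by rewrite birkhoff0 mulr0n.
by rewrite birkhoffSr mulrSr lerD.
Qed.

(** The lower bound [c] of the roof makes the sums grow linearly, so only finitely many roofs are
    crossed in finite time. *)
Lemma birkhoff_floor x t : 0 <= t ->
  exists n, birkhoff tau n x <= t < birkhoff tau n.+1 x.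
Proof.
move=> t0; have [c c0 hc] := roof_bounded_away tau.
have ex : exists n, t < birkhoff tau n x.
  have [n ltn] : exists n : nat, t / c < n%:R.
    exists (Num.bound (t / c)); apply: archi_boundP.
    by rewrite divr_ge0// ltW.
  exists n; apply: (lt_le_trans _ (birkhoff_ge n x hc)).
  by rewrite -mulr_natl -ltr_pdivrMr.
case: (ex_minnP ex) => -[|n] ltn minn.
  by move: ltn; rewrite birkhoff0 ltNge t0.
exists n; rewrite ltn andbT leNgt; apply/negP => /minn.
by rewrite ltnn.
Qed.

(* The flow started at [(x, 0)] is at [z] at time [t]. *)
Definition run x t z := exists n,
  0 <= t - birkhoff tau n x <= tau (iter n sigma x) /\
  z = susp_pt tau (iter n sigma x) (t - birkhoff tau n x).

(** Two descriptions differ only when [t] falls exactly on a roof; the numbers of crossings are then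
    consecutive and the two points are glued. *)
Lemma run_functional x t z z' : run x t z -> run x t z' -> z = z'.
Proof.
move=> [n [/andP[n1 n2] ->]] [m [/andP[m1 m2] ->]].
wlog nm : n m n1 n2 m1 m2 / (n <= m)%N.
  by move=> W; have [nm|/ltnW mn] := leqP n m; [exact: W|apply/esym/W].
move: nm; rewrite leq_eqVlt => /predU1P[->//|nm].
have ltm : m = n.+1.
  apply/eqP; rewrite eqn_leq nm andbT leqNgt; apply/negP => n2m.
  have := birkhoff_le x n2m; have := birkhoff_ltS n.+1 x.
  have := birkhoffSr n x; lra.
subst m; move: n2 m1; rewrite birkhoffSr => n2 m1.
have -> : t - birkhoff tau n x = tau (iter n sigma x) by lra.
have -> : t - (birkhoff tau n x + tau (iter n sigma x)) = 0 by lra.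
by rewrite susp_pt_top.
Qed.

Lemma run_top x t z : run x (tau x + t) z -> 0 <= t -> run (sigma x) t z.
Proof.
move=> [[|n] [/andP[n1 n2] ->]] t0.
  move: n1 n2; rewrite birkhoff0 subr0 /= => n1 n2.
  have -> : t = 0 by lra.
  exists 0%N; rewrite birkhoff0 subr0 /= lexx ltW ?roof_gt0//; split => //.
  by rewrite addr0 susp_pt_top.
exists n; rewrite -iterSr; move: n1 n2; rewrite birkhoffS => n1 n2.
have E : tau x + t - (tau x + birkhoff tau n (sigma x)) =
   t - birkhoff tau n (sigma x) by lra.
by rewrite -E n1 n2.
Qed.

Lemma run_sigma x t z : run (sigma x) t z -> run x (tau x + t) z.
Proof.
move=> [n [h ->]]; exists n.+1; rewrite birkhoffS -!iterSr in h *.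
have E : tau x + t - (tau x + birkhoff tau n (sigma x)) =
   t - birkhoff tau n (sigma x) by lra.
by rewrite E.
Qed.

Lemma run_exists x t : 0 <= t -> exists z, run x t z.
Proof.
move=> /(birkhoff_floor x)[n /andP[n1 n2]].
exists (susp_pt tau (iter n sigma x) (t - birkhoff tau n x)); exists n.
by split => //; move: n2; rewrite birkhoffSr; lra.
Qed.

(** The representative in [flow_to] may sit on the roof; its coordinates are then [(sigma x, 0)],
    and [run_top] removes one crossing. *)
Lemma flow_to_run t y z : 0 <= t ->
  flow_to t y z -> run (coords y).1 ((coords y).2 + t) z.
Proof.
move=> t0 [x [s [n [/andP[s0 st] -> /= nP ->]]]].
have r : run x (s + t) (susp_pt tau (iter n sigma x) (s + t - birkhoff tau n x)).
  by exists n.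
move: st; rewrite le_eqVlt => /predU1P[sE|st].
  move: r; rewrite sE coords_top /= add0r => /run_top; exact.
by rewrite coords_lt//= s0.
Qed.

Lemma flowE t y z : 0 <= t -> flow_to t y z -> flow t y = z.
Proof.
move=> t0 h; rewrite /flow; case: xgetP => [w -> hw|/(_ z)//].
by apply: run_functional (flow_to_run t0 hw) (flow_to_run t0 h).
Qed.

Lemma flow_run x s t z : 0 <= s <= tau x -> 0 <= t ->
  run x (s + t) z -> flow t (susp_pt tau x s) = z.
Proof.
move=> hs t0 [n [nP ->]]; apply: flowE => //.
by exists x, s, n.
Qed.

Definition path_pt x t : suspension tau := flow t (susp_pt tau x 0).

Lemma run_path x t : 0 <= t -> run x t (path_pt x t).
Proof.
move=> t0; have [z rz] := run_exists x t0.
rewrite /path_pt (@flow_run _ _ _ z)// ?add0r//.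
by rewrite lexx ltW// roof_gt0.
Qed.

Lemma path_ptE x t z : 0 <= t -> run x t z -> path_pt x t = z.
Proof. by move=> t0; exact: run_functional (run_path x t0). Qed.

Lemma flow_path x s t : 0 <= s <= tau x -> 0 <= t ->
  flow t (susp_pt tau x s) = path_pt x (s + t).
Proof.
move=> hs t0; apply: flow_run => //; apply: run_path.
by rewrite addr_ge0//; case/andP: hs.
Qed.

Lemma path_pt_lt x s : 0 <= s <= tau x -> path_pt x s = susp_pt tau x s.
Proof.
move=> hs; have /andP[s0 _] := hs; apply: path_ptE => //.
by exists 0%N; rewrite birkhoff0 subr0.
Qed.

Lemma path_pt_top x t : 0 <= t -> path_pt x (tau x + t) = path_pt (sigma x) t.
Proof.
move=> t0; apply: path_ptE; first by rewrite addr_ge0// ltW// roof_gt0.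
by apply: run_sigma; exact: run_path.
Qed.

Lemma path_pt_birkhoff n x t : 0 <= t ->
  path_pt x (birkhoff tau n x + t) = path_pt (iter n sigma x) t.
Proof.
move=> t0; elim: n x => [|n IH] x; first by rewrite birkhoff0 add0r.
rewrite birkhoffS -addrA path_pt_top ?IH -?iterSr// addr_ge0//.
by rewrite -(birkhoff0 (sigma x)) birkhoff_le.
Qed.

End FlowFacts.

(** * Measurability of the coordinates and of the flow *)

(** Generating by cylinders lets measurability and equality of measures be tested on a countable
    family; [open_measurable_cyl] shows that open sets are still measurable. *)
Definition cyl_space (A : transition) : Type :=
  g_sigma_algebraType (range (@cylinder A)).
HB.instance Definition _ (A : transition) := Measurable.copy (cyl_space A)
  (g_sigma_algebraType (range (@cylinder A))).

Section Measurability.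
Variables (A : transition) (R : realType) (tau : roof A R).
Local Notation sigma := (@sigma A).
Local Notation S := (cyl_space A).
Local Notation Y := (borel_suspension tau).
Local Notation P := (S * measurableTypeR R)%type.

Lemma measurable_cylinder w : measurable (cylinder w : set S).
Proof. by apply: sub_sigma_algebra; exists w. Qed.

Lemma open_measurable_cyl (U : set (Sigma A)) : open U -> measurable (U : set S).
Proof.
move=> oU.
rewrite (_ : U = \bigcup_w (if `[< @cylinder A w `<=` U >] then cylinder w else set0)).
  apply: countable_bigcupT_measurable; first exact: countableP.
  by move=> w; case: ifP => _; [exact: measurable_cylinder|exact: measurable0].
apply/seteqP; split=> [x Ux|x [w _]]; last first.
  by case: ifPn => [/asboolP|//]; exact.
have [k kU] := open_agree oU Ux; exists (mkseq (val x) k) => //.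
rewrite ifT; first exact: cylinder_self.
by apply/asboolP => y /cylinder_mkseq; exact: kU.
Qed.

Lemma open_measurable_prod (W : set (Sigma A * R)) :
  open W -> measurable (W : set P).
Proof.
move=> oW.
rewrite (_ : W = \bigcup_(i : seq nat * (rat * rat))
    (if `[< @cylinder A i.1 `*` `]ratr i.2.1, ratr i.2.2[ `<=` W >] then
      cylinder i.1 `*` `]ratr i.2.1, ratr i.2.2[ else set0)).
  apply: countable_bigcupT_measurable; first exact: countableP.
  move=> i; case: ifP => _; last exact: measurable0.
  by apply: measurableX; [exact: measurable_cylinder|exact: measurable_itv].
apply/seteqP; split=> [[x t] Wxt|x [w _]]; last first.
  by case: ifPn => [/asboolP|//]; exact.
have : nbhs (x, t) W by apply: open_nbhs_nbhs.
move=> [[U V] /= [nU nV] UV].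
have [U' [oU' U'x U'U]] : exists U', [/\ open U', U' x & U' `<=` U].
  by move: nU; rewrite nbhsE => -[U' [? ?] ?]; exists U'.
have [k kU] := open_agree oU' U'x.
have [e /= e0 eV] : exists2 e : R, 0 < e & ball t e `<=` V.
  by move: nV => /nbhs_ballP[e e0 ?]; exists e.
have [p /itvP pP] : exists q, ratr q \in `]t - e, t[.
  by apply: rat_in_itvoo; lra.
have [q /itvP qP] : exists q, ratr q \in `]t, t + e[.
  by apply: rat_in_itvoo; lra.
exists (mkseq (val x) k, (p, q)) => //=.
rewrite ifT.
  by split; [exact: cylinder_self|rewrite /= in_itv/= !(pP, qP)].
apply/asboolP => -[y s] /= [/cylinder_mkseq xy]; rewrite in_itv/= => /andP[ps sq].
apply: UV; split=> /=; first exact/U'U/kU.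
apply: eV; rewrite /ball/= ltr_distlC; apply/andP; split.
  by apply: lt_trans ps; rewrite pP.
by apply: (lt_trans sq); rewrite qP.
Qed.

Lemma continuous_measurable_cyl (h : Sigma A -> R) :
  continuous h -> measurable_fun setT (h : S -> R).
Proof.
move=> /continuousP ch; apply: (measurability _ (RGenOInfty.measurableE R)).
move=> _ [_ [x ->] <-]; rewrite setTI.
by apply: open_measurable_cyl; apply: ch; exact: interval_open.
Qed.

Lemma measurable_roof : measurable_fun setT (tau : S -> R).
Proof. by apply: continuous_measurable_cyl; exact: roof_continuous. Qed.

Lemma measurable_sigma : measurable_fun setT (sigma : S -> S).
Proof.
apply: (@measurability _ _ S S setT _ (range (@cylinder A))) => //.
move=> _ [_ [w _ <-] <-]; rewrite setTI.
apply: open_measurable_cyl; move/continuousP: (@sigma_continuous A); apply.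
exact: open_cylinder.
Qed.

Lemma measurable_iter_sigma n : measurable_fun setT (iter n sigma : S -> S).
Proof.
elim: n => [|n IH]; first exact: measurable_id.
exact: (measurableT_comp measurable_sigma IH).
Qed.

Lemma measurable_birkhoff n :
  measurable_fun setT (birkhoff tau n : S -> R).
Proof.
elim: n => [|n IH].
  rewrite (_ : birkhoff _ _ = cst 0); first exact: measurable_cst.
  by apply/funext => x; rewrite birkhoff0.
rewrite (_ : birkhoff _ _ = (birkhoff tau n \+ (fun x => tau (iter n sigma x)))).
  apply: measurable_funD => //.
  exact: (measurableT_comp measurable_roof (measurable_iter_sigma n)).
by apply/funext => x; rewrite birkhoffSr.
Qed.

Lemma measurable_Y0 : measurable (Y0 tau : set P).
Proof.
have -> : Y0 tau = (fun p : P => (0 <= p.2) && (p.2 < tau p.1)) @^-1` [set true].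
  by apply/seteqP; split.
rewrite -[X in measurable X]setTI.
suff : measurable_fun setT (fun p : P => (0 <= p.2) && (p.2 < tau p.1)) by apply.
apply: measurable_and.
  by apply: measurable_fun_ler; [exact: measurable_cst|exact: measurable_snd].
apply: measurable_fun_ltr; first exact: measurable_snd.
exact: (measurableT_comp measurable_roof measurable_fst).
Qed.

Local Open Scope quotient_scope.

Lemma measurable_pt : measurable_fun setT (pt tau : P -> Y).
Proof.
apply: (@measurability _ _ P Y setT _ (@open (suspension tau))) => //.
move=> _ [U oU <-]; rewrite setTI.
have [W oW WU] : exists2 W : set (Sigma A * R), open W &
   (fun p : presusp tau => val p) @^-1` W =
   \pi_({eq_quot (susp_equiv tau)}) @^-1` U by exact: oU.
have WP x t : susp_dom tau (x, t) -> U (susp_pt tau x t) <-> W (x, t).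
  move=> d; rewrite /susp_pt.
  set p := insubd _ _.
  have pE : val p = (x, t) by rewrite val_insubd (mem_set d : _ \in _).
  have : (W (val p)) = U (\pi_({eq_quot (susp_equiv tau)}) p).
    by rewrite -[LHS]/(((fun p => val p) @^-1` W) p) WU.
  by rewrite pE => ->.
pose D : set P := [set p | 0 <= p.2 <= tau p.1].
have mD : measurable D.
  have -> : D = (fun p : P => (0 <= p.2) && (p.2 <= tau p.1)) @^-1` [set true].
    by apply/seteqP; split.
  rewrite -[X in measurable X]setTI.
  suff : measurable_fun setT (fun p : P => (0 <= p.2) && (p.2 <= tau p.1)) by apply.
  apply: measurable_and.
    by apply: measurable_fun_ler; [exact: measurable_cst|exact: measurable_snd].
  apply: measurable_fun_ler; first exact: measurable_snd.
  exact: (measurableT_comp measurable_roof measurable_fst).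
(* Outside [D], [susp_pt] takes its default value, the class of [(x, 0)]. *)
have -> : pt tau @^-1` U = (D `&` W) `|` (~` D `&` (fun p : P => (p.1, 0)) @^-1` W).
  apply/seteqP; split=> [[x t] /= Uxt|[x t] /= [[d /WP]|[nd]]]; last 2 first.
  - exact.
  - move/WP; rewrite /pt /= => h.
    suff -> : susp_pt tau x t = susp_pt tau x 0 by apply: h; exact: susp_dom0.
    rewrite /susp_pt; congr (\pi _).
    apply: val_inj; rewrite !val_insubd /= (mem_set (susp_dom0 tau x) : _ \in _).
    by rewrite ifF//; apply/negP => /set_mem.
  have [d|nd] := pselect (D (x, t)); [left|right]; split => //.
    exact/(WP x t).
  apply/(WP x 0); first exact: susp_dom0.
  rewrite (_ : susp_pt tau x 0 = susp_pt tau x t)//.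
  rewrite /susp_pt; congr (\pi _).
  apply: val_inj; rewrite !val_insubd /= (mem_set (susp_dom0 tau x) : _ \in _).
  by rewrite ifF//; apply/negP => /set_mem.
have mW : measurable (W : set P) by exact: open_measurable_prod.
apply: measurableU; first exact: measurableI.
apply: measurableI; first exact: measurableC.
rewrite -[X in measurable X]setTI.
suff : measurable_fun setT (fun p : P => (p.1, 0) : P) by apply.
apply: measurable_fun_pair; first exact: measurable_fst.
exact: measurable_cst.
Qed.

Lemma open_suspE (U : set (suspension tau)) (W : set (Sigma A * R)) :
  open W -> (forall p : presusp tau, U (\pi p) <-> W (val p)) -> open U.
Proof.
move=> oW UW.
suff : open (\pi_({eq_quot (susp_equiv tau)}) @^-1` U) by [].
have -> : \pi_({eq_quot (susp_equiv tau)}) @^-1` U =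
    (fun p : presusp tau => val p) @^-1` W.
  by apply/seteqP; split=> p /UW.
by exists W.
Qed.

Let fst_cont : continuous (fst : Sigma A * R -> Sigma A).
Proof. by move=> p; exact: cvg_fst. Qed.
Let snd_cont : continuous (snd : Sigma A * R -> R).
Proof. by move=> p; exact: cvg_snd. Qed.
Let tau1_cont : continuous (fun p : Sigma A * R => tau p.1).
Proof.
by move=> p; apply: (@continuous_comp _ _ _ fst); [exact: fst_cont|exact: roof_continuous].
Qed.

Let gap_cont : continuous (fun p : Sigma A * R => tau p.1 - p.2).
Proof. by move=> p; apply: cvgB; [exact: tau1_cont|exact: snd_cont]. Qed.

Lemma open_interior_box w (r : R) : 0 <= r ->
  open [set y : suspension tau | cylinder w (coords y).1 /\ r < (coords y).2 :> R].
Proof.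
move=> r0.
apply: (@open_suspE _ (fst @^-1` (@cylinder A w) `&` (snd @^-1` `]r, +oo[ `&`
   (fun p : Sigma A * R => tau p.1 - p.2) @^-1` `]0, +oo[))).
  apply: openI; [|apply: openI].
  - by move/continuousP: fst_cont; apply; exact: open_cylinder.
  - by move/continuousP: snd_cont; apply; exact: interval_open.
  - by move/continuousP: gap_cont; apply; exact: interval_open.
move=> p; rewrite /= coords_pi /norm_pt !in_itv /= !andbT subr_gt0.
have [lt|ge] := ltP; first by split=> [[]|[? []]].
by split=> [[_ /=]|[_ []//]]; rewrite ltNge r0.
Qed.

(** Before gluing, the zero section over [w] consists of two closed pieces: the floor over [w] and
    the roof over the preimage of [w] under [sigma]. *)
Lemma closed_zero_section w :
  closed [set y : suspension tau | cylinder w (coords y).1 /\ (coords y).2 = 0 :> R].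
Proof.
rewrite -openC.
apply: (@open_suspE _ (~` ((fst @^-1` (@cylinder A w) `&` snd @^-1` [set 0]) `|`
   ((fun p => sigma p.1) @^-1` (@cylinder A w) `&`
    (fun p : Sigma A * R => tau p.1 - p.2) @^-1` [set 0])))).
  rewrite openC; apply: closedU; apply: closedI.
  - by move/continuous_closedP: fst_cont; apply; exact: closed_cylinder.
  - by move/continuous_closedP: snd_cont; apply; exact: closed_eq.
  - suff /continuous_closedP : continuous (fun p : Sigma A * R => sigma p.1).
      by apply; exact: closed_cylinder.
    move=> p; apply: (@continuous_comp _ _ _ fst); first exact: fst_cont.
    exact: sigma_continuous.
  - by move/continuous_closedP: gap_cont; apply; exact: closed_eq.
move=> p; rewrite /= coords_pi /norm_pt.
have /andP[p0 pt'] : 0 <= (val p).2 <= tau (val p).1.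
  exact: (set_mem (valP p) : susp_dom tau (val p)).
have [lt|ge] := ltP; split; apply: contra_not.
- by move=> [//|[_ /eqP]]; rewrite subr_eq0 => /eqP E; rewrite E ltxx in lt.
- by left.
- move=> [[_ E]|[? _]]; last by [].
  by move: ge; rewrite E leNgt roof_gt0.
- by move=> [? _]; right; split => //; apply/eqP; rewrite subr_eq0 eq_le ge.
Qed.

(** [coords] jumps where the roof is glued to the floor, so it is not continuous. The preimage of a
    cylinder is split into an open part above the zero section and a closed part on it. *)
Lemma measurable_coords : measurable_fun setT (@coords A R tau : Y -> P).
Proof.
apply/measurable_fun_pairP; split.
  apply: (@measurability _ _ Y S setT _ (range (@cylinder A))) => //.
  move=> _ [_ [w _ <-] <-]; rewrite setTI.
  have -> : (fst \o @coords _ _ tau) @^-1` (cylinder w) =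
     [set y : suspension tau | cylinder w (coords y).1 /\ 0 < (coords y).2 :> R] `|`
     [set y : suspension tau | cylinder w (coords y).1 /\ (coords y).2 = 0 :> R].
    apply/seteqP; split=> [y wy|y [[]//|[]//]].
    have /andP[] := coords_Y0 y; rewrite le_eqVlt => /predU1P[h _|h _].
      by right.
    by left.
  apply: measurableU.
    by apply: sub_sigma_algebra; exact: open_interior_box.
  rewrite -[X in measurable X]setCK; apply: measurableC.
  by apply: sub_sigma_algebra; rewrite openC; exact: closed_zero_section.
apply: (measurability _ (RGenOInfty.measurableE R)).
move=> _ [_ [r ->] <-]; rewrite setTI.
have [r0|r0] := leP 0 r.
  have -> : (snd \o @coords _ _ tau) @^-1` `]r, +oo[ =
      [set y : suspension tau | cylinder [::] (coords y).1 /\ r < (coords y).2 :> R].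
    by apply/seteqP; split=> [y /=|y [_ /=]]; rewrite in_itv /= andbT.
  by apply: sub_sigma_algebra; exact: open_interior_box.
have -> : (snd \o @coords _ _ tau) @^-1` `]r, +oo[ = setT.
  apply/seteqP; split=> // y _ /=; rewrite in_itv /= andbT.
  by apply: (lt_le_trans r0); have /andP[] := coords_Y0 y.
exact: measurableT.
Qed.

Lemma measurable_path_pt (B : set Y) : measurable B ->
  measurable ([set p | 0 <= p.2 /\ B (path_pt tau p.1 p.2)] : set P).
Proof.
move=> mB.
(* [g n] undoes [n] roof crossings; where its value lies in [Y0], the orbit point is [pt] of it, so
   countably many measurable pieces suffice. *)
pose g n (p : P) : P := (iter n sigma p.1, p.2 - birkhoff tau n p.1).
have mg n : measurable_fun setT (g n).
  apply: measurable_fun_pair.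
    exact: (measurableT_comp (measurable_iter_sigma n) measurable_fst).
  apply: measurable_funB; first exact: measurable_snd.
  exact: (measurableT_comp (measurable_birkhoff n) measurable_fst).
have -> : [set p : P | 0 <= p.2 /\ B (path_pt tau p.1 p.2)] =
    \bigcup_n (g n @^-1` (Y0 tau `&` pt tau @^-1` B)).
  have h n x t : Y0 tau (g n (x, t)) -> path_pt tau x t = pt tau (g n (x, t)).
    move=> /andP[/= n1 n2]; rewrite -[in LHS](subrK (birkhoff tau n x) t) addrC.
    by rewrite path_pt_birkhoff// path_pt_lt// n1 ltW.
  apply/seteqP; split=> [[x t] /= [t0]|[x t] [n _ /= [Yg]]].
    have [n /andP[n1]] := birkhoff_floor tau x t0.
    rewrite birkhoffSr => n2.
    have Yg : Y0 tau (g n (x, t)) by rewrite /Y0 /=; apply/andP; split; lra.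
    by rewrite (h n)// => Bn; exists n.
  rewrite -h//; split => //; move: Yg; rewrite /Y0/= => /andP[+ _].
  rewrite subr_ge0; apply: le_trans.
  by rewrite -(birkhoff0 tau x) birkhoff_le.
apply: bigcupT_measurable => n; rewrite -[X in measurable X]setTI.
apply: mg => //; apply: measurableI; first exact: measurable_Y0.
by rewrite -[X in measurable X]setTI; exact: measurable_pt.
Qed.

Lemma measurable_flow t : 0 <= t ->
  measurable_fun setT (flow t : Y -> Y).
Proof.
move=> t0 _ B mB; rewrite setTI.
have -> : (flow t : Y -> Y) @^-1` B = @coords A R tau @^-1` ((fun p => (p.1, p.2 + t)) @^-1`
   [set p | 0 <= p.2 /\ B (path_pt tau p.1 p.2)]).
  have h (y : suspension tau) : flow t y = path_pt tau (coords y).1 ((coords y).2 + t).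
    rewrite -[in LHS](coordsK y) flow_path//.
    by have /andP[-> /ltW] := coords_Y0 y.
  apply/seteqP; split=> y /=; rewrite h; last by case.
  by split => //; rewrite addr_ge0//; have /andP[] := coords_Y0 y.
have mg : measurable_fun setT (fun p : P => (p.1, p.2 + t) : P).
  apply: measurable_fun_pair; first exact: measurable_fst.
  by apply: measurable_funD; [exact: measurable_snd|exact: measurable_cst].
rewrite -[X in measurable X]setTI; apply: measurable_coords => //.
rewrite -[X in measurable X]setTI; apply: mg => //.
exact: measurable_path_pt.
Qed.

End Measurability.

(** * Pushforwards, finite measures and equality on a cover *)

Section MeasureFacts.
Context d (T : measurableType d) (R : realType).

Lemma pushforward_measure d' (T' : measurableType d')
    (m : {measure set T -> \bar R}) (f : T -> T') :
  measurable_fun [set: T] f ->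
  exists m' : {measure set T' -> \bar R}, forall A, m' A = m (f @^-1` A).
Proof.
move=> mf; unshelve eexists.
  by refine (pushforward m f : {measure set T' -> \bar R}); exact: mf.
by [].
Qed.

Section FiniteMeasureOf.
Variables (m : {measure set T -> \bar R}) (moo : (m setT < +oo)%E).

(* The vacuous [let] makes the constant depend on the bound, which the instance below
   needs. *)
Definition finite_measure_fun : set T -> \bar R := let _ := moo in m.

HB.instance Definition _ := Measure.copy finite_measure_fun m.

Let fin_finite_measure_fun : fin_num_fun finite_measure_fun.
Proof.
move=> A mA; rewrite ge0_fin_numE//; apply: le_lt_trans moo.
by apply: le_measure; rewrite ?inE.
Qed.

HB.instance Definition _ :=
  Measure_isFinite.Build _ _ _ finite_measure_fun fin_finite_measure_fun.

End FiniteMeasureOf.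

Lemma finite_measure_of (m : {measure set T -> \bar R}) :
  (m setT < +oo)%E ->
  exists m' : {finite_measure set T -> \bar R}, forall A, m' A = m A.
Proof. by move=> moo; exists (finite_measure_fun moo). Qed.

Lemma measure_eq_on_cover (m1 m2 : {measure set T -> \bar R})
    (F : nat -> set T) :
  (forall n, measurable (F n)) ->
  (forall n E, measurable E -> E `<=` F n -> m1 E = m2 E) ->
  forall E, measurable E -> E `<=` \bigcup_n F n -> m1 E = m2 E.
Proof.
move=> mF m12 E mE EF.
have mD k : measurable (seqDU F k).
  by apply: measurableD => //; apply: bigsetU_measurable.
have EE : E = \bigcup_k (E `&` seqDU F k).
  by rewrite -setI_bigcupr -seqDU_bigcup_eq; apply/esym/setIidl.
have tE : trivIset setT (fun k => E `&` seqDU F k).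
  exact/trivIset_setIl/trivIset_seqDU.
rewrite EE !measure_bigcup//; try by move=> k _; exact: measurableI.
apply: eq_eseriesr => k _; apply: (m12 k); first exact: measurableI.
by move=> x [_ []].
Qed.

End MeasureFacts.

(** * Disintegration of invariant measures *)

(** Cauchy's functional equation on an interval: nonnegativity makes [phi] monotone, and bracketing
    [h] between consecutive multiples of [q / n] leaves an error of at most [q * phi q / n]. *)
Lemma additive_linear (R : realType) (phi : R -> R) (q h : R) :
  0 < q -> (forall a, 0 <= a <= q -> 0 <= phi a) ->
  (forall a b, 0 <= a -> 0 <= b -> a + b <= q -> phi (a + b) = phi a + phi b) ->
  0 <= h <= q -> phi h * q = h * phi q.
Proof.
move=> q0 phi0 phiD /andP[h0 hq].
have phi_nat n k : (0 < n)%N -> (k <= n)%N ->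
    phi (k%:R * (q / n%:R)) = k%:R * phi (q / n%:R).
  move=> n0; elim: k => [|k IH] kn.
    have := phiD 0 0 (lexx _) (lexx _); rewrite addr0 => /(_ (ltW q0)) E.
    by rewrite !mul0r; lra.
  have nn : (0 : R) < n%:R by rewrite ltr0n.
  rewrite -natr1 mulrDl mul1r phiD ?IH ?mulrDl ?mul1r//; try exact: ltnW.
  - by rewrite mulr_ge0// ?divr_ge0// ltW.
  - by rewrite divr_ge0// ltW.
  - rewrite -[X in _ + X]mul1r -mulrDl natr1 mulrCA ler_piMr// ?(ltW q0)//.
    by rewrite ler_pdivrMr// mul1r ler_nat.
have phi_mono a b : 0 <= a -> a <= b -> b <= q -> phi a <= phi b.
  move=> a0 ab bq; rewrite -(subrK a b) addrC phiD//; last 2 first.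
  - by rewrite subr_ge0.
  - by rewrite addrC subrK.
  by rewrite lerDl phi0// subr_ge0 ab/= (le_trans _ bq)// gerBl.
have key n : (0 < n)%N -> `|phi h * q - h * phi q| <= q * phi q / n%:R.
  move=> n0; have nn : (0 : R) < n%:R by rewrite ltr0n.
  have nn0 : n%:R != 0 :> R by rewrite gt_eqF.
  have qn0 : 0 < q / n%:R by rewrite divr_gt0.
  have phin : phi q = n%:R * phi (q / n%:R).
    by rewrite -phi_nat// mulrC divfK.
  set p := phi (q / n%:R) in phi_nat phin.
  have p0 : 0 <= p.
    apply/phi0/andP; split; first exact: ltW.
    by rewrite ler_pdivrMr// ler_peMr ?ler1n// ltW.
  set k := Num.truncn (h / (q / n%:R)).
  have /andP[k1 k2] : k%:R <= h / (q / n%:R) < k.+1%:R.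
    by apply: truncn_itv; rewrite divr_ge0// ltW.
  rewrite ler_pdivlMr// in k1; rewrite ltr_pdivrMr// in k2.
  have kn : (k <= n)%N.
    rewrite -(ler_nat R) -(ler_pM2r qn0); apply: (le_trans k1).
    by rewrite mulrC divfK.
  have l1 : k%:R * p <= phi h.
    by rewrite -phi_nat//; apply: phi_mono => //; exact: mulr_ge0 (ler0n _ _) (ltW qn0).
  have l2 : phi h <= k.+1%:R * p.
    have [kn'|kn'] := ltnP k n.
      rewrite -phi_nat//; apply: phi_mono => //; [exact: ltW|].
      rewrite mulrCA ler_piMr// ?(ltW q0)//.
      by rewrite ler_pdivrMr// mul1r ler_nat.
    have -> : k = n by apply/eqP; rewrite eqn_leq kn kn'.
    apply: (le_trans (phi_mono _ _ h0 hq (lexx q))).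
    by rewrite phin -natr1 mulrDl mul1r lerDl.
  rewrite phin.
  have -> : q * (n%:R * p) / n%:R = q * p by rewrite [n%:R * p]mulrC mulrA mulfK.
  have -> : h * (n%:R * p) = (h * n%:R) * p by rewrite mulrA.
  have k1' : k%:R * q <= h * n%:R by move: k1; rewrite mulrA ler_pdivrMr.
  have k2' : h * n%:R <= k.+1%:R * q by apply: ltW; move: k2; rewrite mulrA ltr_pdivlMr.
  rewrite -natr1 in k2' l2.
  have m1 := ler_wpM2r (ltW q0) l1; have m2 := ler_wpM2r (ltW q0) l2.
  have m3 := ler_wpM2r p0 k1'; have m4 := ler_wpM2r p0 k2'.
  by rewrite ler_norml; apply/andP; split; lra.
apply/eqP; rewrite -subr_eq0 -normr_le0 leNgt; apply/negP => e0.
set e := `|_| in e0.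
have [n nP] : exists n : nat, q * phi q / e < n%:R.
  exists (Num.bound (q * phi q / e)); apply: archi_boundP.
  apply: divr_ge0; last exact: ltW.
  by apply: mulr_ge0; [exact: ltW|apply: phi0; rewrite lexx ltW].
have := key n.+1 isT; rewrite -/e ler_pdivlMr ?ltr0n//.
move: nP; rewrite ltr_pdivrMr// => nP; rewrite -natr1 mulrDr mulr1.
rewrite mulrC in nP; lra.
Qed.

Section Disintegration.
Variables (A : transition) (R : realType) (tau : roof A R).
Local Notation sigma := (@sigma A).
Local Notation S := (cyl_space A).
Local Notation Y := (borel_suspension tau).
Local Notation P := (S * measurableTypeR R)%type.
Local Notation lam := (@lebesgue_measure R).

Lemma coords_path_le x (r : R) : 0 <= r -> (coords (path_pt tau x r)).2 <= r.
Proof.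
move=> r0; have [n [/andP[n1 n2] ->]] := run_path tau x r0.
have Sn : 0 <= birkhoff tau n x by rewrite -(birkhoff0 tau x) birkhoff_le.
move: n2; rewrite le_eqVlt => /predU1P[->|lt].
  by rewrite coords_top.
by rewrite coords_lt ?n1//= lerBlDr lerDl.
Qed.

Lemma flow_coords (y : suspension tau) t : 0 <= t ->
  flow t y = path_pt tau (coords y).1 ((coords y).2 + t).
Proof.
move=> t0; rewrite -[in LHS](coordsK y) flow_path//.
by have /andP[-> /ltW] := coords_Y0 y.
Qed.

Lemma coords_path_lt x (r : R) : 0 <= r < tau x ->
  coords (path_pt tau x r) = (x, r).
Proof.
by move=> h; have /andP[r0 /ltW rt] := h; rewrite path_pt_lt ?r0// coords_lt.
Qed.

Lemma measurable_roof_ge (q : R) : measurable ([set x | q <= tau x] : set S).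
Proof.
have -> : [set x | q <= tau x] = tau @^-1` `[q, +oo[.
  by apply/seteqP; split=> x /=; rewrite in_itv/= andbT.
by rewrite -[X in measurable X]setTI; apply: measurable_roof.
Qed.

Section Invariant.
Variables (nu : probability Y R) (nu_inv : flow_invariant nu).

Let N : {measure set P -> \bar R} :=
  sval (cid (pushforward_measure nu (@measurable_coords A R tau))).

Let NE E : N E = nu (@coords A R tau @^-1` E).
Proof. exact: (svalP (cid (pushforward_measure nu (@measurable_coords A R tau)))). Qed.

Let N_le1 E : measurable E -> (N E <= 1)%E.
Proof.
move=> mE; rewrite NE; apply: probability_le1.
by rewrite -[X in measurable X]setTI; exact: measurable_coords.
Qed.

Let N_fin E : measurable E -> N E \is a fin_num.
Proof.
move=> mE; rewrite ge0_fin_numE//; apply: (le_lt_trans (N_le1 mE)).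
exact: ltry.
Qed.

Let N_flow t E : 0 <= t -> measurable E ->
  N E = nu (flow t @^-1` (@coords A R tau @^-1` E)).
Proof.
move=> t0 mE; rewrite NE; apply/esym; apply: nu_inv => //.
by rewrite -[X in measurable X]setTI; exact: measurable_coords.
Qed.

Let slab (C : set S) (p q : R) : set P := C `*` `[p, q[.

Let measurable_slab (C : set S) p q : measurable C -> measurable (slab C p q).
Proof. by move=> mC; apply: measurableX => //; exact: measurable_itv. Qed.

(** Below the roof the flow only raises the height by [s]. An orbit which crosses the roof arrives
    at a height less than [s <= p], hence cannot land in the slab. *)
Let N_shift (C : set S) (p q s : R) : measurable C -> (forall x, C x -> q <= tau x) ->
  0 <= s <= p -> N (slab C p q) = N (slab C (p - s) (q - s)).
Proof.
move=> mC Cq /andP[s0 sp]; rewrite (@N_flow s)//; last exact: measurable_slab.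
rewrite [in RHS]NE; congr (nu _); apply/seteqP; split=> y; rewrite /slab /=.
  rewrite flow_coords// !in_itv/=.
  have /andP[u0 ut] := coords_Y0 y; set x := (coords y).1 in ut *.
  set u := (coords y).2 in u0 ut *.
  have [lt|ge] := ltP (u + s) (tau x).
    rewrite coords_path_lt/=; last by rewrite addr_ge0.
    by move=> [Cx /andP[h1 h2]]; split => //; lra.
  have -> : u + s = tau x + (u + s - tau x) by lra.
  have r0 : 0 <= u + s - tau x by lra.
  rewrite path_pt_top// => -[_ /andP[h1 _]].
  by have := coords_path_le (sigma x) r0; lra.
rewrite flow_coords// !in_itv/=.
have /andP[u0 ut] := coords_Y0 y; set x := (coords y).1 in ut *.
set u := (coords y).2 in u0 ut *.
move=> [Cx /andP[h1 h2]].
have := Cq _ Cx => h3.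
rewrite coords_path_lt/=; last by apply/andP; split; lra.
by split => //; lra.
Qed.

Let c : R := sval (cid2 (roof_bounded_away tau)).
Let c0 : 0 < c. Proof. exact: (s2valP (cid2 (roof_bounded_away tau))). Qed.
Let ctau x : c <= tau x. Proof. exact: (s2valP' (cid2 (roof_bounded_away tau)) x). Qed.

(** Every fiber has length at least [c], so the slab of height [c] over any [C] lies below the roof;
    its mass per unit height is the base measure. *)
Let m (C : set S) : \bar R := ((c^-1)%:E * N (slab C 0 c))%E.

(* By invariance under the flow, the mass of a slab depends only on its height; it is
   additive in it, hence linear. *)
Let N_slab (C : set S) (q a b : R) : measurable C -> (forall x, C x -> q <= tau x) ->
  0 <= a -> a <= b -> b <= q -> N (slab C a b) = ((b - a)%:E * m C)%E.
Proof.
move=> mC Cq a0 ab bq.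
(* As [tau] is at least [c] everywhere, [q] may be raised to [c]; linearity on [[0, q]] can then be
   used both at [b - a] and at [c]. *)
wlog cq : q Cq bq / c <= q.
  move=> W; have [/W|/ltW qc] := leP c q; first exact.
  by apply: (W c) => //; exact: le_trans qc.
have ms p r : measurable (slab C p r) by exact: measurable_slab.
rewrite (@N_shift _ _ _ a)//; last 2 first.
- by move=> x /Cq; exact: le_trans.
- by rewrite a0 lexx.
rewrite subrr; set h := b - a.
pose phi r := fine (N (slab C 0 r)).
have phiE r : N (slab C 0 r) = (phi r)%:E by rewrite fineK// N_fin.
have lin r : 0 <= r <= q -> phi r * q = r * phi q.
  apply: additive_linear; first exact: lt_le_trans cq.
    by move=> ? _; rewrite fine_ge0.
  move=> u v u0 v0 uv; apply: EFin_inj; rewrite EFinD -!phiE.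
  have -> : slab C 0 (u + v) = slab C 0 u `|` slab C u (u + v).
    apply/seteqP; split=> [[x t]|[x t] [|]]; rewrite /slab/= !in_itv/=.
    - by move=> [Cx /andP[t0 tuv]]; have [tu|tu] := ltP t u; [left|right]; rewrite ?t0.
    - by move=> [Cx /andP[t0 tu]]; split => //; lra.
    - by move=> [Cx /andP[t0 tu]]; split => //; lra.
  rewrite measureU//; last first.
    apply/seteqP; split=> // -[x t]; rewrite /slab/= !in_itv/=.
    by move=> [[_ /andP[_ tu]] [_ /andP[ut _]]]; lra.
  congr (_ + _)%E; transitivity (N (slab C (u - u) (u + v - u))).
    apply: N_shift => //; last by rewrite u0 lexx.
    by move=> x /Cq; exact: le_trans uv.
  by rewrite subrr [u + v]addrC addrK.
have q0 : 0 < q by exact: lt_le_trans cq.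
have l1 := lin h; have l2 := lin c; rewrite /m !phiE -!EFinM; congr (_%:E).
have {}l1 : phi h * q = h * phi q by apply: l1; rewrite /h; apply/andP; split; lra.
have {}l2 : phi c * q = c * phi q by apply: l2; rewrite cq ltW.
apply: (mulIf (lt0r_neq0 q0)); rewrite l1 -!mulrA l2.
by rewrite mulKf// gt_eqF.
Qed.

Lemma disintegration : exists m : {finite_measure set S -> \bar R},
  forall B : set Y, measurable B ->
  nu B = (m \x lam)%E (Y0 tau `&` pt tau @^-1` B).
Proof.
have ms C p r : measurable C -> measurable (slab C p r) by exact: measurable_slab.
pose Nc := mrestr N (ms setT 0 c measurableT).
have [m0 m0E] := pushforward_measure Nc (@measurable_fst _ _ S (measurableTypeR R)).
have ci0 : 0 <= c^-1 by rewrite invr_ge0 ltW.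
pose m1 : {measure set S -> \bar R} := mscale (NngNum ci0) m0.
have m1E C : m1 C = m C.
  rewrite -[LHS]/((c^-1)%:E * m0 C)%E m0E /m; congr (_ * N _)%E.
  by apply/seteqP; split=> -[x t]/= [? []]//=.
have m1oo : (m1 setT < +oo)%E.
  rewrite m1E /m lte_mul_pinfty// ?lee_fin// ltey_eq N_fin//.
  exact: measurable_slab.
have [m2 m2E] := finite_measure_of m1oo.
have {}m2E C : m2 C = m C by rewrite m2E m1E.
exists m2 => B mB.
pose D q : set S := [set x | q <= tau x].
have mD q : measurable (D q) by exact: measurable_roof_ge.
(* [D q x [0, q[] lies below the roof, and both measures are products there; these
   slabs with [q] rational cover the region below the roof. *)
have rect q (C : set S) (E : set (measurableTypeR R)) : 0 <= q -> measurable C -> measurable E ->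
   N ((C `*` E) `&` slab (D q) 0 q) = (m2 \x lam)%E ((C `*` E) `&` slab (D q) 0 q).
  move=> q0 mC mE.
  have mCD : measurable (C `&` D q) by exact: measurableI.
  have CDq x : (C `&` D q) x -> q <= tau x by move=> [].
  have setE (E' : set (measurableTypeR R)) : (C `*` E') `&` slab (D q) 0 q = (C `&` D q) `*` (E' `&` `[0, q[).
    by rewrite /slab setXI.
  have mE' : measurable (E `&` `[0, q[) by apply: measurableI => //; exact: measurable_itv.
  rewrite setE.
  transitivity (m2 (C `&` D q) * lam (E `&` `[0%R, q[))%E; last first.
    by apply/esym; exact: product_measure1E.
  rewrite m2E.
  have [k1 k1E] := pushforward_measure (mrestr N (ms _ 0 q mCD)) (@measurable_snd _ _ S (measurableTypeR R)).
  have mCfin : m (C `&` D q) \is a fin_num.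
    by rewrite /m fin_numM//; apply: N_fin; exact: measurable_slab.
  have mC0 : 0 <= fine (m (C `&` D q)).
    by rewrite fine_ge0// /m mule_ge0// lee_fin.
  pose k2 : {measure set (measurableTypeR R) -> \bar R} :=
    mscale (NngNum mC0) (mrestr lam (measurable_itv `[0, q[)).
  have k2E A' : k2 A' = (m (C `&` D q) * lam (A' `&` `[0%R, q[))%E.
    rewrite -[LHS]/((fine (m (C `&` D q)))%:E * lam (A' `&` `[0%R, q[))%E.
    by rewrite fineK.
  have k1E' A' : k1 A' = N ((C `&` D q) `*` (A' `&` `[0, q[)).
    rewrite k1E; congr (N _); apply/seteqP.
    by split=> -[x t]; rewrite /slab /=; tauto.
  rewrite -k1E' -k2E.
  (* For fixed [C] both sides are measures of the set of heights. They are compared on half-lines,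
     whose traces on [[0, q[] are intervals covered by [N_slab]. *)
  apply: (@measure_unique _ R (measurableTypeR R) (@RGenCInfty.G R)
    (fun n => `[(- n%:R)%R, +oo[%classic) (RGenCInfty.measurableE R) _ _ _ k1 k2 _ _ E mE) => //.
  - move=> _ _ [x ->] [y ->]; exists (Num.max x y).
    apply/seteqP; split=> z /=; rewrite !in_itv/= !andbT ge_max.
      by move=> [-> ->].
    by move/andP.
  - by move=> i; exists (- i%:R).
  - apply/seteqP; split=> // x _; exists (Num.bound `|x|) => //=.
    rewrite in_itv/= andbT lerNl.
    by apply: ltW; apply: (le_lt_trans (ler_norm _)); rewrite normrN archi_boundP ?normr_ge0.
  - move=> _ [x ->]; rewrite k1E' k2E.
    have E1 : `[x, +oo[ `&` `[0, q[ = `[Num.max x 0, q[%classic :> set R.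
      apply/seteqP; split=> z /=; rewrite !in_itv/= !andbT ge_max.
        by move=> [-> /andP[-> ->]].
      by move=> /andP[/andP[-> ->] ->].
    rewrite E1.
    have [qx|xq] := ltP q (Num.max x 0).
      rewrite (_ : `[_, q[%classic = set0 :> set R).
        by rewrite setX0 !measure0 mule0.
      by rewrite set_itv_ge// bnd_simp -leNgt ltW.
    rewrite (@N_slab _ q)//; last by rewrite le_max lexx orbT.
    rewrite muleC; congr (_ * _)%E.
    by rewrite lebesgue_measure_itv/= lte_fin; case: ltP => // h; congr (_%:E); lra.
  - move=> k; rewrite k1E'; apply: (@le_lt_trans _ _ 1%E); last exact: ltry.
    by apply: N_le1; apply: measurableX => //; apply: measurableI; exact: measurable_itv.
have agreeq q E : 0 <= q -> measurable E -> E `<=` slab (D q) 0 q ->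
    N E = (m2 \x lam)%E E.
  move=> q0 mE Eq.
  have msl : measurable (slab (D q) 0 q) by exact: measurable_slab.
  have {1}-> : E = E `&` slab (D q) 0 q by apply/esym/setIidl.
  have {2}-> : E = E `&` slab (D q) 0 q by apply/esym/setIidl.
  pose n1 : {measure set P -> \bar R} := mrestr N msl.
  pose n2 : {measure set P -> \bar R} := mrestr (m2 \x lam)%E msl.
  rewrite -[LHS]/(n1 E) -[RHS]/(n2 E).
  apply: (measure_unique [set A1 `*` A2 | A1 in measurable & A2 in measurable]
    (fun=> setT)) => //.
  - by rewrite measurable_prod_measurableType.
  - move=> _ _ [A1 mA1 [A2 mA2 <-]] [B1 mB1 [B2 mB2 <-]].
    rewrite -setXI; exists (A1 `&` B1); first exact: measurableI.
    by exists (A2 `&` B2) => //; exact: measurableI.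
  - by move=> _; exists setT => //; exists setT => //; rewrite setXTT.
  - by apply/seteqP; split=> // x _; exists 0%N.
  - by move=> _ [A1 mA1 [A2 mA2 <-]]; exact: rect.
  - move=> _; rewrite /n1 /= /mrestr; apply: (@le_lt_trans _ _ 1%E); last exact: ltry.
    by apply: N_le1; exact: measurableI.
have mYB : measurable (Y0 tau `&` pt tau @^-1` B : set P).
  apply: measurableI; first exact: measurable_Y0.
  by rewrite -[X in measurable X]setTI; exact: measurable_pt.
have -> : nu B = N (Y0 tau `&` pt tau @^-1` B).
  rewrite NE; congr (nu _); apply/seteqP; split=> y /=; rewrite coordsK//.
    by split => //; exact: coords_Y0.
  by case.
pose F (i : nat) : set P := if unpickle i is Some q then
  slab (D `|ratr (q : rat)|) 0 `|ratr q| else set0.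
apply: (measure_eq_on_cover (F := F)) => //.
- move=> i; rewrite /F; case: unpickle => [q|]; last exact: measurable0.
  exact: measurable_slab.
- move=> i E mE; rewrite /F; case: unpickle => [q Eq|].
    by apply: (agreeq _ _ _ mE Eq).
  by rewrite subset0 => ->; rewrite !measure0.
- move=> [x t] [/andP[/= t0 tx] _].
  have [q /itvP qP] : exists q, ratr q \in `]t, tau x[ by exact: rat_in_itvoo.
  exists (pickle q); first exact: Logic.I.
  rewrite /F pickleK /slab/= in_itv/=.
  have q0 : (0 : R) <= ratr q by apply: (le_trans t0); rewrite ltW// qP.
  rewrite (ger0_norm q0) t0 /=; split; first by rewrite /D /= qP.
  by rewrite qP.
Qed.

End Invariant.
End Disintegration.

(** * Integrals and invariance of the base measure *)

Lemma ge0_integral_mrestr d (T : measurableType d) (R : realType)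
    (mu : {measure set T -> \bar R}) (D : set T) (mD : measurable D)
    (f : T -> \bar R) :
  measurable_fun setT f -> (forall x, (0 <= f x)%E) ->
  (\int[mrestr mu mD]_x f x = \int[mu]_(x in D) f x)%E.
Proof.
move=> mf f0; have mDC : measurable (~` D) by exact: measurableC.
rewrite -(setUv D) ge0_integral_setU//; last 2 first.
- by rewrite setUv.
- by rewrite /disj_set setICr.
rewrite [X in (_ + X)%E]null_set_integral ?adde0//; last 2 first.
- exact: measurable_funTS.
- by rewrite -[LHS]/(mu (~` D `&` D)) setICl.
apply: eq_measure_integral => E mE ED.
by rewrite -[LHS]/(mu (E `&` D)) (setIidl ED).
Qed.

Section BaseMeasure.
Variables (A : transition) (R : realType) (tau : roof A R).
Local Notation sigma := (@sigma A).
Local Notation S := (cyl_space A).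
Local Notation Y := (borel_suspension tau).
Local Notation P := (S * measurableTypeR R)%type.
Local Notation lam := (@lebesgue_measure R).

Definition fiber_integral (g : suspension tau -> R) (x : S) : \bar R :=
  (\int[lam]_(t in `[0%R, tau x[) (g (susp_pt tau x t))%:E)%E.

Let lift (g : suspension tau -> R) (p : P) : \bar R :=
  if p \in Y0 tau then (g (pt tau p))%:E else 0%E.

Let measurable_lift g : measurable_fun setT (g : Y -> R) ->
  measurable_fun setT (lift g).
Proof.
move=> mg; rewrite [lift g](_ : _ = ((EFin \o (g \o pt tau)) \_ (Y0 tau : set P))).
  apply/(measurable_restrictT _ (measurable_Y0 tau)).
  apply: measurable_funTS; apply/measurable_EFinP.
  exact: (measurableT_comp mg (@measurable_pt A R tau)).
by apply/funext => p; rewrite /lift /patch.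
Qed.

Let lift_fiber g x :
  (\int[lam]_t lift g (x, t))%E = fiber_integral g x.
Proof.
rewrite /fiber_integral [RHS]integral_mkcond; apply: eq_integral => t _.
by rewrite /lift /patch; congr (if _ then _ else _).
Qed.

Lemma measurable_fiber_integral g : measurable_fun setT (g : Y -> R) ->
  (forall y, 0 <= g y) -> measurable_fun setT (fiber_integral g).
Proof.
move=> mg g0; rewrite [fiber_integral g](_ : _ = fubini_F lam (lift g)).
  apply: measurable_fun_fubini_tonelli_F; first exact: measurable_lift.
  by move=> p; rewrite /lift; case: ifP => // _; rewrite lee_fin.
by apply/funext => x; rewrite -lift_fiber.
Qed.

Section Disintegrated.
Variables (nu : {measure set Y -> \bar R}) (m : {finite_measure set S -> \bar R}).
Hypothesis nuE : forall B : set Y, measurable B ->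
  nu B = (m \x lam)%E (Y0 tau `&` pt tau @^-1` B).

Lemma integral_base g : measurable_fun setT (g : Y -> R) ->
  (forall y, 0 <= g y) ->
  (\int[nu]_y (g y)%:E = \int[m]_x fiber_integral g x)%E.
Proof.
move=> mg g0.
pose k0 := mrestr (m \x lam)%E (measurable_Y0 tau).
have mpt := @measurable_pt A R tau.
transitivity (\int[pushforward k0 (pt tau : P -> Y)]_y (g y)%:E)%E.
  apply: eq_measure_integral => B mB _.
  by rewrite nuE// /pushforward /k0 /mrestr setIC.
rewrite ge0_integral_pushforward//; last 2 first.
- exact/measurable_EFinP.
- by move=> y _; rewrite lee_fin.
rewrite preimage_setT /k0 ge0_integral_mrestr//; last 2 first.
- by apply/measurable_EFinP; exact: measurableT_comp mg mpt.
- by move=> p /=; rewrite lee_fin.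
transitivity (\int[m \x lam]_p lift g p)%E.
  by rewrite [LHS]integral_mkcond; apply: eq_integral.
rewrite fubini_tonelli1; last 2 first.
- exact: measurable_lift.
- by move=> p; rewrite /lift; case: ifP => // _; rewrite lee_fin.
by apply: eq_integral => x _; rewrite -lift_fiber.
Qed.

(** The slab of height [c] over [C] is reached after time [c] exactly from the top slices of height
    [c] of the fibers over the preimage of [C], since at most one roof is crossed. Both sets have
    the same [nu]-mass. *)
Lemma base_invariant (C : set S) : flow_invariant nu -> measurable C ->
  m (sigma @^-1` C) = m C.
Proof.
move=> nu_inv mC; have [c c0 ctau] := roof_bounded_away tau.
have mCs : measurable (sigma @^-1` C : set S).
  by rewrite -[X in measurable X]setTI; exact: measurable_sigma.
pose B : set Y := @coords A R tau @^-1` (C `*` `[0, c[).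
have mB : measurable B.
  rewrite /B -[X in measurable X]setTI.
  apply: (@measurable_coords A R tau measurableT (C `*` `[0, c[)).
  by apply: measurableX => //; exact: measurable_itv.
have nuB : nu B = (m C * c%:E)%E.
  transitivity ((m \x lam)%E (C `*` `[0, c[)).
    rewrite nuE//; congr product_measure1; apply/seteqP; split=> -[x t] /=.
      by move=> [Yxt]; rewrite /B /= ptK.
    rewrite in_itv/= => -[Cx /andP[t0 tc]].
    have Yxt : Y0 tau (x, t) by rewrite /Y0/= t0 (lt_le_trans tc).
    by split => //; rewrite /B /= ptK//=; split => //; rewrite in_itv/= t0.
  transitivity (m C * lam `[0%R, c[%classic)%E; first exact: product_measure1E.
  by rewrite lebesgue_measure_itv/= lte_fin c0 oppr0 adde0.
have nuB' : nu (flow c @^-1` B) = (m (sigma @^-1` C) * c%:E)%E.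
  rewrite nuE; last first.
    rewrite -[X in measurable X]setTI.
    exact: (@measurable_flow A R tau c (ltW c0) measurableT B mB).
  rewrite /product_measure1.
  rewrite (eq_integral (fun x : S => (\1_(sigma @^-1` C) x)%:E * c%:E)%E); last first.
    move=> x _.
    have flowB u : 0 <= u -> u < tau x ->
        B (flow c (susp_pt tau x u)) <-> C (sigma x) /\ tau x - c <= u.
      move=> u0 ux; rewrite /B /= flow_path; [|by rewrite u0 ltW|exact: ltW].
      have [lt|ge] := ltP (u + c) (tau x).
        rewrite coords_path_lt/=; last by rewrite addr_ge0// ltW.
        rewrite in_itv/=; split=> [[_ /andP[_ h]]|[_ h]]; exfalso; lra.
      have -> : u + c = tau x + (u + c - tau x) by lra.
      have r0 : 0 <= u + c - tau x by lra.
      have rt : u + c - tau x < tau (sigma x).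
        by apply: lt_le_trans (ctau _); lra.
      rewrite path_pt_top// coords_path_lt ?r0//= in_itv/= r0/=.
      by split=> [[? _]|[? _]]; split => //; lra.
    have [Cx|nCx] := pselect (C (sigma x)).
      rewrite indicE mem_set// mul1e /=.
      rewrite (_ : xsection _ _ = `[tau x - c, tau x[%classic).
        have := ctau x => cx.
        rewrite lebesgue_measure_itv/= lte_fin ifT; last by rewrite ltrBlDr ltrDl.
        by congr (_%:E); lra.
      apply/seteqP; split=> u.
        move=> /xsectionP[/andP[/= u0 ux] /(flowB _ u0 ux)[_ h]].
        by rewrite in_itv/= h.
      have := ctau x => cx; rewrite /= in_itv/= => /andP[h1 h2].
      have u0 : 0 <= u by lra.
      by apply/xsectionP; split; [rewrite /Y0/= u0|apply/flowB].
    rewrite indicE memNset// mul0e /= (_ : xsection _ _ = set0) ?measure0//.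
    apply/seteqP; split=> u //.
    by move=> /xsectionP[/andP[/= u0 ux] /(flowB _ u0 ux)[]].
  rewrite ge0_integralZr//; last 2 first.
  - by apply/measurable_EFinP; exact: measurable_indic.
  - by rewrite lee_fin ltW.
  by rewrite integral_indic// setIT.
have := nu_inv c (ltW c0) B mB; rewrite nuB nuB'.
have f1 := fin_num_measure m _ mC; have f2 := fin_num_measure m _ mCs.
rewrite -(fineK f1) -(fineK f2) -!EFinM => -[] /(mulIf (lt0r_neq0 c0)) ->.
by [].
Qed.

End Disintegrated.
End BaseMeasure.

(** * Translation invariance of Lebesgue measure *)

Section Translation.
Variable R : realType.
Local Notation lam := (@lebesgue_measure R).
Implicit Types (a : R) (D : set (measurableTypeR R)).

Let measurable_shift a : measurable_fun setT
  ((fun t => t + a) : measurableTypeR R -> measurableTypeR R).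
Proof. by apply: measurable_funD; [exact: measurable_id|exact: measurable_cst]. Qed.

Lemma lebesgue_measure_shift a D : measurable D ->
  lam ((fun t => t + a) @^-1` D) = lam D.
Proof.
move=> mD; have [k kE] := pushforward_measure lam (measurable_shift a).
rewrite -kE; apply/esym; apply: lebesgue_measure_unique => // _ [[p q] _ <-].
rewrite kE.
have -> : (fun t : R => t + a) @^-1` `]p, q]%classic = `]p - a, q - a]%classic.
  by apply/seteqP; split=> t /=; rewrite !in_itv/= ltrBlDr lerBrDr.
rewrite [LHS]lebesgue_measure_itv [RHS]lebesgue_measure_itv /= !lte_fin ltrD2r.
case: ifP => // _.
by congr (_%:E); lra.
Qed.

Lemma integral_shift a D (h : R -> \bar R) : measurable D ->
  measurable_fun D h ->
  (\int[lam]_(t in D) h t = \int[lam]_(t in (fun t => (t + a)%R) @^-1` D) h (t + a)%R)%E.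
Proof.
move=> mD mh.
have key (g : R -> \bar R) : measurable_fun D g -> (forall t, 0 <= g t)%E ->
  (\int[lam]_(t in D) g t = \int[lam]_(t in (fun t => (t + a)%R) @^-1` D) g (t + a)%R)%E.
  move=> mg g0.
  transitivity (\int[pushforward lam ((fun t => (t + a)%R) : measurableTypeR R -> measurableTypeR R)]_(t in D) g t)%E.
    apply: eq_measure_integral => E mE _.
    by rewrite -[LHS](lebesgue_measure_shift a mE).
  by rewrite ge0_integral_pushforward.
rewrite integralE [RHS]integralE; congr (_ - _)%E.
  by rewrite (key h^\+%E (measurable_funepos mh) (funepos_ge0 h)); apply: eq_integral => t _; rewrite !funeposE.
by rewrite (key h^\-%E (measurable_funeneg mh) (funeneg_ge0 h)); apply: eq_integral => t _; rewrite !funenegE.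
Qed.

End Translation.

(** * Integrals along fibers and orbits *)

Section FlowIntegrals.
Variables (A : transition) (R : realType) (tau : roof A R).
Local Notation sigma := (@sigma A).
Local Notation S := (cyl_space A).
Local Notation Y := (borel_suspension tau).
Local Notation lam := (@lebesgue_measure R).

Lemma continuous_measurable_susp (g : suspension tau -> R) :
  continuous g -> measurable_fun setT (g : Y -> R).
Proof.
move=> /continuousP cg; apply: (measurability _ (RGenOInfty.measurableE R)).
move=> _ [_ [x ->] <-]; rewrite setTI.
by apply: sub_sigma_algebra; apply: cg; exact: interval_open.
Qed.

Variables (f : suspension tau -> R) (f_cont : continuous f).

Local Open Scope quotient_scope.

Lemma fiber_continuous x : {within `[0, tau x], continuous (fun t => f (susp_pt tau x t))}.
Proof.
(* Clamping extends the fiber to a continuous map on the whole line, which agrees with the given one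
   on [[0, tau x]]. *)
pose clamp (t : R) := Num.max 0 (Num.min t (tau x)).
have clampP t : susp_dom tau (x, clamp t).
  by rewrite /susp_dom /clamp /= le_max lexx/= ge_max ge_min lexx orbT ltW ?roof_gt0.
pose lft (t : R) : presusp tau := SigSub (mem_set (clampP t)).
have lft_cont : continuous lft.
  apply/continuousP => U [V oV VU].
  have -> : lft @^-1` U = (fun t => (x, clamp t)) @^-1` V.
    by rewrite -VU.
  suff /continuousP : continuous (fun t : R => (x, clamp t)) by apply.
  move=> t.
  apply: (@cvg_pair _ _ _ (nbhs t) (nbhs x) (nbhs (clamp t)) _ _ _ (cst x) clamp).
    exact: cvg_cst.
  apply: (@continuous_max R R (cst 0) (fun t => Num.min t (tau x)) t).
    exact: cvg_cst.
  apply: (@continuous_min R R id (cst (tau x)) t); first exact: cvg_id.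
  exact: cvg_cst.
pose h (t : R) := f (\pi_({eq_quot (susp_equiv tau)}) (lft t)).
have h_cont : continuous h.
  move=> t; apply: (@continuous_comp _ _ _ (fun t => \pi_({eq_quot (susp_equiv tau)}) (lft t) : suspension tau) f).
    apply: (@continuous_comp _ _ _ lft (fun p => \pi_({eq_quot (susp_equiv tau)}) p : suspension tau)).
      exact: lft_cont.
    exact: (@pi_continuous _ {eq_quot (susp_equiv tau)}).
  exact: f_cont.
apply: (@subspace_eq_continuous _ _ _ h); last exact: continuous_subspaceT.
move=> t; rewrite inE/= in_itv/= => /andP[t0 tt].
have ct : clamp t = t by rewrite /clamp (min_idPl tt) (max_idPr t0).
rewrite /h /susp_pt; congr (f (\pi _)); apply: val_inj.
rewrite val_insubd /= ct ifT//.
by apply/mem_set; rewrite /susp_dom/= t0.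
Qed.

Lemma fiber_integrable x :
  lam.-integrable `[0, tau x] (EFin \o (fun t => f (susp_pt tau x t))).
Proof.
apply: continuous_compact_integrable; first exact: segment_compact.
exact: fiber_continuous.
Qed.

Lemma Delta_fiber x : fiber_integral f x = (Delta f x)%:E.
Proof.
rewrite /fiber_integral integral_itv_bndo_bndc; last first.
  apply: (@measurable_funS _ _ _ _ `[0, tau x]) => //.
    by apply: subset_itvl; rewrite bnd_simp.
  by have /integrableP[] := fiber_integrable x.
rewrite /Delta /Rintegral fineK//.
exact/integrable_fin_num/fiber_integrable.
Qed.

Lemma fiber_integral_subr (M : R) x :
  fiber_integral (fun y => M - f y) x = (M * tau x - Delta f x)%:E.
Proof.
have t0 := roof_gt0 tau x.
rewrite EFinB -Delta_fiber /fiber_integral.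
under eq_integral do rewrite EFinB.
have sub : (`[0, tau x[%classic : set (measurableTypeR R)) `<=` `[0, tau x]%classic by apply: subset_itvl; rewrite bnd_simp.
have mI b : measurable ([set` Interval (BLeft 0) b] : set (measurableTypeR R)) by exact: measurable_itv.
rewrite integralB//; last 2 first.
- apply: (integrableS (mI (BRight (tau x))) (mI (BLeft (tau x))) sub).
  apply: (@continuous_compact_integrable R (cst M)); first exact: segment_compact.
  by apply: continuous_subspaceT => ?; exact: cvg_cst.
- exact: (integrableS (mI _) (mI _) sub (fiber_integrable x)).
congr (_ - _)%E; rewrite integral_cst//= lebesgue_measure_itv/= lte_fin t0.
by rewrite oppr0 adde0.
Qed.

Lemma measurable_path x :
  measurable_fun (`[0, +oo[%classic : set (measurableTypeR R))
    (fun t => f (path_pt tau x t)).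
Proof.
move=> _ B mB.
have mf := continuous_measurable_susp f_cont.
have mfB : measurable (f @^-1` B : set Y) by rewrite -[X in measurable X]setTI; exact: mf.
have := measurable_xsection (x : S) (measurable_path_pt mfB).
congr (measurable _); apply/seteqP; split=> t.
  by move=> /xsectionP[/= t0 Bt]; rewrite in_itv/= t0.
by rewrite /= in_itv/= andbT => -[t0 Bt]; apply/xsectionP.
Qed.

Lemma path_integral n x :
  (\int[lam]_(t in `[0%R, birkhoff tau n x[) (f (path_pt tau x t))%:E =
   (\sum_(k < n) Delta f (iter k sigma x))%:E)%E.
Proof.
have mp u (I : set (measurableTypeR R)) : measurable I -> I `<=` `[0, +oo[%classic ->
    measurable_fun I (fun t => (f (path_pt tau u t))%:E).
  move=> mI I0; apply/measurable_EFinP.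
  by apply: measurable_funS I0 (measurable_path u); exact: measurable_itv.
elim: n x => [|n IH] x.
  by rewrite birkhoff0 big_ord0 set_itv_ge ?integral_set0// bnd_simp ltxx.
have t0 := roof_gt0 tau x.
have Sn0 : 0 <= birkhoff tau n (sigma x).
  by rewrite -(birkhoff0 tau (sigma x)) birkhoff_le.
have -> : `[0, birkhoff tau n.+1 x[%classic = `[0, tau x[%classic `|`
    `[tau x, birkhoff tau n.+1 x[%classic :> set R.
  apply/seteqP; split=> t /=; rewrite birkhoffS !in_itv/=.
    by move=> /andP[h0 h1]; case: (ltP t (tau x)) => h; [left|right]; rewrite ?h0.
  by move=> [|] /andP[h0 h1]; apply/andP; split; lra.
have top0 (t : R) : tau x <= t -> 0 <= t by move=> h; lra.
have mt : measurable_fun (`[tau x, birkhoff tau n.+1 x[%classic : set (measurableTypeR R))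
    (fun t => (f (path_pt tau x t))%:E).
  apply: mp; first exact: measurable_itv.
  by move=> t /=; rewrite !in_itv/= andbT => /andP[/top0].
rewrite integral_setU; [|exact: measurable_itv|exact: measurable_itv| |]; last 2 first.
- apply: mp; first by apply: measurableU; exact: measurable_itv.
  by move=> t [] /=; rewrite !in_itv/= andbT => /andP[//] => /top0.
- apply/disj_setPS => t /= []; rewrite !in_itv/= => /andP[_ h] /andP[h' _]; lra.
rewrite big_ord_recl EFinD; congr (_ + _)%E.
  rewrite -[in RHS]Delta_fiber /fiber_integral; apply: eq_integral => t.
  by rewrite inE/= in_itv/= => /andP[h0 h1]; rewrite path_pt_lt// h0 ltW.
rewrite (eq_bigr (fun k : 'I_n => Delta f (iter k sigma (sigma x)))); last first.
  by move=> i _; rewrite -iterSr.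
rewrite -IH (integral_shift (tau x) (measurable_itv _) mt).
have -> : (fun t => t + tau x) @^-1` `[tau x, birkhoff tau n.+1 x[ =
   `[0, birkhoff tau n (sigma x)[%classic.
  by apply/seteqP; split=> t /=; rewrite birkhoffS !in_itv/= => /andP[h0 h1]; apply/andP; split; lra.
apply: eq_integral => t; rewrite inE/= in_itv/= => /andP[h0 h1].
by rewrite addrC path_pt_top.
Qed.

End FlowIntegrals.

(** * Finite pressure and the cost of loops *)

Lemma esum_finite_superlevel (R : realType) (T : choiceType) (I : set T)
    (u : T -> \bar R) (d : R) :
  (forall i, I i -> 0 <= u i)%E -> (\esum_(i in I) u i < +oo)%E -> 0 < d ->
  finite_set [set i | I i /\ (d%:E <= u i)%E].
Proof.
move=> u0 uoo d0; apply: contrapT => inf.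
have e0 : (0 <= \esum_(i in I) u i)%E by exact: esum_ge0.
have efin : \esum_(i in I) u i \is a fin_num by rewrite ge0_fin_numE.
set e := fine (\esum_(i in I) u i).
have eE : \esum_(i in I) u i = e%:E by rewrite fineK.
have [B BI nB] := infinite_set_fset (Num.truncn (e / d)).+1 inf.
have : ((d *+ size (enum_fset B))%:E <= e%:E)%E.
  rewrite -eE; apply: esum_ge; exists [set` B].
    by split; [exact: finite_fset|move=> i /BI[]].
  rewrite fsbig_finite/=; last exact: finite_fset.
  rewrite set_fsetK; apply: (@le_trans _ _ (\sum_(i <- enum_fset B) d%:E)%E).
    by rewrite sumEFin big_const_seq count_predT iter_addr addr0.
  by rewrite big_seq [leRHS]big_seq; apply: lee_sum => i /BI[].
rewrite lee_fin => h.
have : e < d *+ size (enum_fset B).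
  rewrite -mulr_natl -ltr_pdivrMr//; apply: lt_le_trans (truncnS_gt _) _.
  by rewrite ler_nat.
by lra.
Qed.

(** * Admissible words and periodic points *)

Section Words.
Variable A : transition.
Local Notation sigma := (@sigma A).

Lemma adj_total a : exists b, A a b.
Proof.
have [[|b w] /andP[]] := adj_transitive A a a.+1.
  by move=> _ /= /eqP /n_Sn.
by move=> /= /andP[Aab _] _; exists b.
Qed.

Lemma long_path n a b : exists w,
  [/\ path A a w, last a w = b & (n <= size w)%N].
Proof.
elim: n a => [|n IH] a.
  by have [w /andP[? /eqP ?]] := adj_transitive A a b; exists w.
have [a' aa'] := adj_total a; have [w [pw lw sw]] := IH a'.
by exists (a' :: w); split => //=; rewrite aa'.
Qed.

Lemma periodic_point a w : path A a w -> last a w = a -> (0 < size w)%N ->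
  exists y : Sigma A, iter (size w) sigma y = y /\
    forall n, (n <= size w)%N -> val y n = nth 0%N (a :: w) n.
Proof.
move=> pw lw w0.
(* The word [a :: w] returns to [a] at its end, so the period is [size w] and the formula for the
   letters still holds at [n = size w]. *)
pose z n := nth 0%N (a :: w) (n %% size w).
have zE n : (n <= size w)%N -> z n = nth 0%N (a :: w) n.
  rewrite /z leq_eqVlt => /predU1P[->|h]; last by rewrite modn_small.
  by rewrite modnn /= -[LHS]lw nth_last.
have zS : shift_space A z.
  move=> n; set k := (n %% size w)%N.
  have kw : (k < size w)%N by rewrite ltn_pmod.
  have -> : z n = nth 0%N (a :: w) k by [].
  have -> : z n.+1 = nth 0%N (a :: w) k.+1.
    by rewrite -zE// /z /k -addn1 -[in RHS]addn1 modnDml.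
  by move/pathP : pw; exact.
exists (SigSub (mem_set zS)); split=> //.
apply: Sigma_ext => i; rewrite iter_sigmaE /= /z.
by rewrite modnDl.
Qed.

(** The junction letter is shared: place [size u] is both the end of [a :: u] and the start of the
    following word. *)
Lemma nth_cat_path a u w k :
  nth 0%N (a :: (u ++ w)) (size u + k) = nth 0%N (last a u :: w) k.
Proof.
case: k => [|k]; last by rewrite addnS /= nth_cat ltnNge leq_addr/= addKn.
by rewrite addn0 -cat_cons nth_cat ltnSn/= nth_last.
Qed.

Lemma nth_cat_path_l a u w n : (n <= size u)%N ->
  nth 0%N (a :: (u ++ w)) n = nth 0%N (a :: u) n.
Proof. by move=> nu; rewrite -cat_cons nth_cat ltnS nu. Qed.

End Words.

(** * Birkhoff sums and bounded distortion *)

Section BirkhoffSums.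
Variables (A : transition) (R : realType).
Local Notation sigma := (@sigma A).
Implicit Types (phi : Sigma A -> R) (x y : Sigma A).

Definition bsum phi n x : R := \sum_(k < n) phi (iter k sigma x).

Lemma bsum0 phi x : bsum phi 0 x = 0.
Proof. by rewrite /bsum big_ord0. Qed.

Lemma bsumS phi n x : bsum phi n.+1 x = phi x + bsum phi n (sigma x).
Proof.
rewrite /bsum big_ord_recl /=; congr (_ + _); apply: eq_bigr => i _.
by rewrite -iterS iterSr.
Qed.

Lemma bsumD phi m n x :
  bsum phi (m + n) x = bsum phi m x + bsum phi n (iter m sigma x).
Proof.
elim: m x => [|m IH] x; first by rewrite bsum0 add0r.
by rewrite addSn !bsumS IH addrA -iterSr.
Qed.

Lemma shift_variation_ge0 n phi : (0 <= Defs.variation n phi)%E.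
Proof.
apply: ereal_sup_ubound; exists (point, point) => //=.
by rewrite subrr normr0.
Qed.

Lemma shift_variation_ge n phi x y : agree n x y ->
  (`|phi x - phi y|%:E <= Defs.variation n phi)%E.
Proof. by move=> xy; apply: ereal_sup_ubound; exists (x, y). Qed.

(** After [k < n] shifts the points still agree on [n + 1 - k >= 2] letters, so the differences are
    bounded by variations of distinct orders, all at least 2. This is why one more letter than the
    length of the sum must agree. *)
Lemma bounded_distortion phi : summable_variations phi ->
  exists2 V : R, 0 <= V & forall n x y, agree n.+1 x y ->
    `|bsum phi n x - bsum phi n y| <= V.
Proof.
move=> sv; pose s := (\sum_(2 <= n <oo) Defs.variation n phi)%E.
have s0 : (0 <= s)%E by apply: nneseries_ge0 => *; exact: shift_variation_ge0.
have sfin : s \is a fin_num by rewrite ge0_fin_numE.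
exists (fine s); first exact: fine_ge0.
move=> n x y xy; rewrite -lee_fin fineK//.
apply: (@le_trans _ _ (\sum_(2 <= k < n.+2) Defs.variation k phi)%E); last first.
  by apply: nneseries_lim_ge => *; exact: shift_variation_ge0.
elim: n x y xy => [|n IH] x y xy.
  by rewrite !bsum0 subrr normr0 big_geq.
rewrite big_nat_recr//= !bsumS.
have h1 : agree n.+1 (sigma x) (sigma y) by move=> i ilt; apply: xy.
apply: (@le_trans _ _ (`|bsum phi n (sigma x) - bsum phi n (sigma y)|%:E +
   `|phi x - phi y|%:E)%E).
  rewrite -EFinD lee_fin opprD addrACA addrC.
  exact: ler_normD.
by apply: leeD; [exact: IH|exact: shift_variation_ge].
Qed.

End BirkhoffSums.

Section LoopCost.
Variables (A : transition) (R : realType) (tau : roof A R).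
Variables (f : suspension tau -> R) (f_cont : continuous f).
Local Notation sigma := (@sigma A).

(** An infinite sum has logarithm [+oo], which stays [+oo] after division by [T > 0]; a finite upper
    limit excludes this for large [T]. *)
Lemma pressure_finite_sums a d1 d2 : (pressure a d1 d2 f < +oo)%E ->
  exists2 T0 : R, 0 < T0 & forall T, T0 <= T ->
    (\esum_(xs in FPer tau a (T - d1) (T + d2))
      (expR (\int[lebesgue_measure]_(t in `[0, xs.2])
         f (flow t (susp_pt tau xs.1 0))))%:E < +oo)%E.
Proof.
move=> /ereal_inf_lt[_ [V [M [_ MV]] <-] Voo].
exists (Num.max M 0 + 1) => [|T hT]; first by rewrite ltr_wpDl// le_max lexx orbT.
have MT : M < T by apply: lt_le_trans hT; rewrite (le_lt_trans (_ : M <= Num.max M 0)) ?ltrDl// le_max lexx.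
have T0 : 0 < T by apply: lt_le_trans hT; rewrite ltr_wpDl// le_max lexx orbT.
set E := \esum_(_ in _) _.
have := le_lt_trans (ereal_sup_ubound (imageP _ (MV _ MT))) Voo.
rewrite -/E => h; rewrite ltey; apply/eqP => EE; move: h; rewrite EE /=.
by rewrite gt0_muley ?lte_fin ?invr_gt0// ltxx.
Qed.

Lemma FPer_periodic a n (y : Sigma A) T1 T2 : val y 0%N = a ->
  iter n sigma y = y -> T1 <= birkhoff tau n y <= T2 ->
  FPer tau a T1 T2 (y, birkhoff tau n y).
Proof.
move=> ya yn yT; have b0 : 0 <= birkhoff tau n y.
  by rewrite -(birkhoff0 tau y) birkhoff_le.
split => //=; first by case.
rewrite -[LHS]/(path_pt tau y (birkhoff tau n y)) -[birkhoff tau n y]addr0.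
rewrite path_pt_birkhoff// yn path_pt_lt// lexx ltW//; exact: roof_gt0.
Qed.

Lemma path_Rintegral n (y : Sigma A) :
  \int[lebesgue_measure]_(t in `[0, birkhoff tau n y])
     f (flow t (susp_pt tau y 0)) = bsum (Delta f) n y.
Proof.
rewrite /Rintegral -integral_itv_bndo_bndc; last first.
  apply/measurable_EFinP; apply: measurable_funS (measurable_path f_cont y).
    exact: measurable_itv.
  by move=> t /=; rewrite !in_itv/= andbT => /andP[].
by rewrite (path_integral f_cont n y).
Qed.

Variables (tau_var : summable_variations tau).
Variables (Df_var : summable_variations (Delta f)).
Variables (M : R) (M0 : 0 <= M) (Dle : forall x, tau x <= M * tau x - Delta f x).

(* A cheap loop at [i] starting with [i j], preceded by a fixed word from [a] to [i] and
   followed by a fixed word from [i] to [a], becomes a periodic orbit of bounded period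
   along which the integral of [f] is bounded below.  The first word is long enough for
   the period to exceed the threshold beyond which the sums in the pressure are finite. *)
Lemma loop_cost a d1 d2 (i : nat) (N : R) :
  0 < d1 -> 0 <= d2 -> (pressure a d1 d2 f < +oo)%E ->
  exists J, forall (x : Sigma A) r, val x 0%N = i -> (J <= val x 1)%N ->
    (0 < r)%N -> val x r = i ->
    N < bsum (fun x => M * tau x - Delta f x) r x.
Proof.
move=> d10 d20 /pressure_finite_sums[T0 T00 T0P].
set G := fun x => M * tau x - Delta f x.
have [Vt Vt0 VtP] := bounded_distortion tau_var.
have [Vd Vd0 VdP] := bounded_distortion Df_var.
have [c c0 ctau] := roof_bounded_away tau.
have [u [pu lu su]] := long_path A (Num.truncn (T0 / c)).+1 a i.
have [v /andP[pv /eqP lv]] := adj_transitive A i a.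
have u0 : (0 < size u)%N by exact: leq_trans su.
have Tu : T0 <= c *+ size u.
  rewrite -mulr_natl -ler_pdivrMr//; apply: ltW; apply: (lt_le_trans (truncnS_gt _)).
  by rewrite ler_nat.
(* The word [u ++ v] is itself a loop at [a]. Its periodic point is a reference for the sums along
   [u] and [v], so that their estimates do not depend on the inserted loop. *)
have [y0 [_ y0E]] : exists y : Sigma A, iter (size (u ++ v)) sigma y = y /\
    forall n, (n <= size (u ++ v))%N -> val y n = nth 0%N (a :: (u ++ v)) n.
  apply: periodic_point; rewrite ?cat_path ?last_cat ?lu ?pu//.
  by rewrite size_cat addn_gt0 u0.
pose cost (phi : Sigma A -> R) := bsum phi (size u) y0 + bsum phi (size v) (iter (size u) sigma y0).
(* Each of the three pieces [u], loop, [v] costs one distortion constant. Along the loop, the sum of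
   [tau] is at most [N] and that of [Delta f] is at least [-N]. *)
pose Tmax := cost tau + N + 3 * Vt.
pose Dmin := cost (Delta f) - N - 3 * Vd.
pose bad : set (Sigma A) := [set x | val x 0%N = i /\
  exists2 r, (0 < r)%N & val x r = i /\ bsum G r x <= N].
have loop x : bad x -> exists y s, [/\ T0 <= s <= Tmax,
    forall T1 T2, T1 <= s <= T2 -> FPer tau a T1 T2 (y, s),
    Dmin <= \int[lebesgue_measure]_(t in `[0, s]) f (flow t (susp_pt tau y 0))
  & val y (size u).+1 = val x 1%N].
  move=> [xi [r r0 [xr Gr]]].
  pose g := mkseq (fun k => val x k.+1) r.
  have xg n : (n <= r)%N -> nth 0%N (i :: g) n = val x n.
    by case: n => [|n] nr //=; rewrite nth_mkseq.
  have sg : size g = r by rewrite size_mkseq.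
  have pg : path A i g.
    apply/(pathP 0%N) => n; rewrite sg => nr.
    rewrite -[X in A X]/(nth 0%N (i :: g) n) -[X in A _ X]/(nth 0%N (i :: g) n.+1).
    by rewrite (xg _ (ltnW nr)) (xg _ nr); exact: SigmaP.
  have lg : last i g = i by rewrite -[LHS]/(last 0%N (i :: g)) -nth_last -[X in nth _ _ X]/(size g) sg xg.
  pose w := u ++ (g ++ v).
  have sw : size w = (size u + (r + size v))%N by rewrite !size_cat sg.
  have [y [yper yE]] : exists y : Sigma A, iter (size w) sigma y = y /\
      forall n, (n <= size w)%N -> val y n = nth 0%N (a :: w) n.
    apply: periodic_point; rewrite ?cat_path ?last_cat ?lu ?pu ?pg ?lg//.
    by rewrite sw addn_gt0 u0.
  have yu : agree (size u).+1 y y0.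
    move=> n; rewrite ltnS => nu.
    rewrite yE ?sw ?(leq_trans nu) ?leq_addr// y0E ?size_cat ?(leq_trans nu) ?leq_addr//.
    by rewrite !nth_cat_path_l.
  have yx : agree r.+1 (iter (size u) sigma y) x.
    move=> n; rewrite ltnS => nr; rewrite iter_sigmaE.
    rewrite yE ?sw ?leq_add2l ?(leq_trans nr) ?leq_addr// nth_cat_path lu.
    by rewrite nth_cat_path_l ?sg// xg.
  have yv : agree (size v).+1 (iter (size u + r) sigma y) (iter (size u) sigma y0).
    move=> n; rewrite ltnS => nv; rewrite !iter_sigmaE -addnA.
    rewrite yE ?sw ?leq_add2l// nth_cat_path lu -[r in (r + n)%N]sg nth_cat_path lg.
    by rewrite y0E ?size_cat ?leq_add2l// nth_cat_path lu.
  have split (phi : Sigma A -> R) (V : R) : (forall n x y, agree n.+1 x y -> `|bsum phi n x - bsum phi n y| <= V) ->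
      `|bsum phi (size w) y - (cost phi + bsum phi r x)| <= 3 * V.
    move=> VP; rewrite sw !bsumD -iterD [(r + size u)%N]addnC.
    have := VP _ _ _ yu; have := VP _ _ _ yx; have := VP _ _ _ yv; rewrite /cost.
    by rewrite !ler_norml => /andP[? ?] /andP[? ?] /andP[? ?]; apply/andP; split; lra.
  have bG : bsum G r x = M * bsum tau r x - bsum (Delta f) r x.
    by rewrite /bsum mulr_sumr -sumrB.
  have tG : bsum tau r x <= bsum G r x by apply: ler_sum => k _; exact: Dle.
  have t0 : 0 <= bsum tau r x by apply: sumr_ge0 => k _; rewrite ltW// roof_gt0.
  have Mt : 0 <= M * bsum tau r x by exact: mulr_ge0.
  have := split _ _ VtP; have := split _ _ VdP; rewrite !ler_norml => /andP[D1 D2] /andP[t1 t2].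
  exists y, (birkhoff tau (size w) y); split.
  - apply/andP; split; last by rewrite /Tmax -[birkhoff _ _ _]/(bsum tau (size w) y); lra.
    apply: (le_trans Tu); apply: (le_trans (birkhoff_ge (size u) y ctau)).
    by apply: birkhoff_le; rewrite sw leq_addr.
  - move=> T1 T2 hT; apply: FPer_periodic => //.
    by rewrite yE.
  - by rewrite path_Rintegral /Dmin; lra.
  - rewrite yE; last by rewrite sw -[X in (X <= _)%N]addn1 leq_add2l addn_gt0 r0.
    by rewrite -[(size u).+1]addn1 nth_cat_path lu nth_cat_path_l ?sg// xg.
(* A finite sum of nonnegative terms has only finitely many terms above the fixed level
   [expR Dmin]. *)
pose heavy T : set (Sigma A * R) := [set p | FPer tau a (T - d1) (T + d2) p /\
  ((expR Dmin)%:E <= (expR (\int[lebesgue_measure]_(t in `[0, p.2])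
         f (flow t (susp_pt tau p.1 0))))%:E)%E].
have heavy_fin T : T0 <= T -> finite_set (heavy T).
  move=> hT; apply: (esum_finite_superlevel _ (T0P _ hT)); last exact: expR_gt0.
  by move=> p _; rewrite lee_fin expR_ge0.
(* The windows are centred at [T0 + k * d1], beyond the finiteness threshold; as each reaches back
   by [d1], those with [k <= K] cover [[T0, Tmax]]. *)
pose K := (Num.truncn ((Tmax - T0) / d1)).+1.
have fin : finite_set (\bigcup_(k in `I_K.+1) heavy (T0 + k%:R * d1)).
  apply: bigcup_finite; first exact: finite_II.
  by move=> k _; apply: heavy_fin; rewrite lerDl mulr_ge0// ltW.
have fin2 : finite_set [set val p.1 (size u).+1 | p in
    \bigcup_(k in `I_K.+1) heavy (T0 + k%:R * d1)] by exact: finite_image.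
have [J JP] : exists J, forall j, [set val p.1 (size u).+1 | p in
    \bigcup_(k in `I_K.+1) heavy (T0 + k%:R * d1)] j -> (j < J)%N.
  have [F FE] := finite_fsetP.1 fin2.
  exists (\max_(j <- enum_fset F) j).+1 => j; rewrite FE /= => jF.
  by rewrite ltnS; apply: leq_bigmax_seq.
exists J => x r xi xJ r0 xr; rewrite ltNge; apply/negP => Gr.
have [y [s [/andP[s1 s2] sP sD yx]]] : exists y s, [/\ T0 <= s <= Tmax,
    forall T1 T2, T1 <= s <= T2 -> FPer tau a T1 T2 (y, s),
    Dmin <= \int[lebesgue_measure]_(t in `[0, s]) f (flow t (susp_pt tau y 0))
  & val y (size u).+1 = val x 1%N].
  by apply: loop; split => //; exists r.
suff : (val x 1%N < J)%N by rewrite ltnNge xJ.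
apply: JP; exists (y, s) => //=.
pose k := (Num.truncn ((s - T0) / d1)).+1.
have sT0 : 0 <= (s - T0) / d1 by rewrite divr_ge0 ?subr_ge0// ltW.
have /andP[k1 k2] : (Num.truncn ((s - T0) / d1))%:R <= (s - T0) / d1 < k%:R.
  exact: truncn_itv.
rewrite ler_pdivlMr// in k1; rewrite ltr_pdivrMr// in k2.
exists k.
  rewrite /= ltnS /k /K ltnS le_truncn// ler_pM2r ?invr_gt0// lerD2r//.
split; last by rewrite lee_fin ler_expR.
apply: sP; rewrite /k -natr1 mulrDl mul1r; rewrite /k -natr1 mulrDl mul1r in k2.
by apply/andP; split; lra.
Qed.

End LoopCost.

(** * Counting visits under an invariant measure *)

Section Tightness.
Variables (A : transition) (R : realType).
Local Notation sigma := (@sigma A).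
Local Notation S := (cyl_space A).

Section VisitCount.
Variables (G : Sigma A -> R) (E : set (Sigma A)) (N : R).
Hypotheses (G0 : forall x, 0 <= G x) (N0 : 0 <= N).
Hypothesis loopN : forall x r, E x -> (0 < r)%N -> E (iter r sigma x) ->
  N <= bsum G r x.

Local Notation cnt := (bsum (\1_E : Sigma A -> R)).

(** The cost accumulated since the last visit [z] is carried through the induction and pays for the
    next visit, whatever the waiting time [r]. *)
Let cnt_after_visit L z r : E z -> (0 < r)%N ->
  N * cnt L (iter r sigma z) <= bsum G r z + bsum G L (iter r sigma z).
Proof.
elim: L z r => [|L IH] z r Ez r0.
  by rewrite !bsum0 mulr0 addr0; apply: sumr_ge0.
rewrite !bsumS indicE; have [Ex|nEx] := pselect (E (iter r sigma z)).
  rewrite mem_set//= mulrDr mulr1.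
  have := loopN Ez r0 Ex; have := IH _ 1%N Ex isT.
  by rewrite /= bsumS bsum0 addr0; lra.
rewrite memNset//= add0r.
have := IH z r.+1 Ez isT; rewrite -[in X in X -> _]addn1 bsumD bsumS bsum0 addr0.
by rewrite addn1 /=; lra.
Qed.

(** The extra [N] accounts for the first visit, which closes no loop. *)
Lemma visit_count L x : N * cnt L x <= bsum G L x + N.
Proof.
elim: L x => [|L IH] x; first by rewrite !bsum0 mulr0 add0r.
rewrite !bsumS indicE; have [Ex|nEx] := pselect (E x).
  rewrite mem_set//= mulrDr mulr1.
  by have := @cnt_after_visit L x 1%N Ex isT; rewrite /= bsumS bsum0 addr0; lra.
rewrite memNset//= add0r; apply: (le_trans (IH _)).
by have := G0 x; lra.
Qed.

End VisitCount.

Section InvariantMeasure.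
Variable m : {finite_measure set S -> \bar R}.
Hypothesis m_inv : forall C : set S, measurable C -> m (sigma @^-1` C) = m C.

Lemma integral_sigma (g : S -> \bar R) : measurable_fun setT g ->
  (forall x, 0 <= g x)%E -> (\int[m]_x g (sigma x) = \int[m]_x g x)%E.
Proof.
move=> mg g0.
transitivity (\int[pushforward m (sigma : S -> S)]_x g x)%E; last first.
  by apply: eq_measure_integral => [|? C mC _]; [exact: measurable_sigma|exact: m_inv].
by rewrite ge0_integral_pushforward//; exact: measurable_sigma.
Qed.

Lemma integral_iter_sigma k (g : S -> \bar R) : measurable_fun setT g ->
  (forall x, 0 <= g x)%E -> (\int[m]_x g (iter k sigma x) = \int[m]_x g x)%E.
Proof.
move=> mg g0; elim: k => [//|k IH].
rewrite -[RHS]IH -(integral_sigma (g := fun x => g (iter k sigma x)))//.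
  by apply: eq_integral => x _; rewrite -iterSr.
exact: (measurableT_comp mg (measurable_iter_sigma k)).
Qed.

Lemma integral_bsum L (g : S -> R) : measurable_fun setT g ->
  (forall x, 0 <= g x) ->
  (\int[m]_x (bsum g L x)%:E = L%:R%:E * \int[m]_x (g x)%:E)%E.
Proof.
move=> mg g0.
transitivity (\int[m]_x (\sum_(k < L) (g (iter k sigma x))%:E))%E.
  by apply: eq_integral => x _; rewrite sumEFin.
rewrite ge0_integral_sum//; last 2 first.
- move=> k; apply/measurable_EFinP.
  exact: (measurableT_comp mg (measurable_iter_sigma k)).
- by move=> k x _; rewrite lee_fin.
rewrite (eq_bigr (fun=> \int[m]_x (g x)%:E)%E); last first.
  move=> k _; rewrite (integral_iter_sigma k (g := fun x => (g x)%:E))//.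
  exact/measurable_EFinP.
elim: L => [|L IH]; first by rewrite big_ord0 mul0e.
by rewrite big_ord_recr /= IH -natr1 EFinD ge0_muleDl ?mul1e// lee_fin.
Qed.

(** Integrating [visit_count] against an invariant measure turns orbit sums into [L] times space
    integrals, without an ergodic theorem. The length [L] stays free: after division by [N * L], the
    boundary term [C0 / L] vanishes only for large [L]. *)
Lemma visit_bound (G : S -> R) (E : set S) (N K C0 : R) (L : nat) :
  measurable_fun setT G -> (forall x, 0 <= G x) -> measurable E -> 0 <= N ->
  (forall x r, E x -> (0 < r)%N -> E (iter r sigma x) -> N <= bsum G r x) ->
  (\int[m]_x (G x)%:E <= K%:E)%E -> (m setT <= C0%:E)%E ->
  N * L%:R * fine (m E) <= L%:R * K + N * C0.
Proof.
move=> mG G0 mE N0 loopN GK mC0.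
have mEE : m E = (fine (m E))%:E by rewrite fineK// fin_num_measure.
have mbs L' (g : S -> R) : measurable_fun setT g -> measurable_fun setT (bsum g L' : S -> R).
  move=> mg; rewrite /bsum; apply: measurable_sum => k.
  exact: (measurableT_comp mg (measurable_iter_sigma k)).
have m1 : measurable_fun setT (\1_E : S -> R) by exact: measurable_indic.
have : (\int[m]_x (N * bsum (\1_E : S -> R) L x)%:E <=
        \int[m]_x (bsum G L x + N)%:E)%E.
  apply: ge0_le_integral => //.
  - move=> x _; rewrite lee_fin mulr_ge0//; apply: sumr_ge0 => k _.
    by rewrite indicE.
  - by apply/measurable_EFinP/measurable_funM; [exact: measurable_cst|exact: mbs].
  - by apply/measurable_EFinP/measurable_funD; [exact: mbs|exact: measurable_cst].
  - by move=> x _; rewrite lee_fin; exact: visit_count.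
under eq_integral do rewrite EFinM.
under [X in (_ <= X)%E]eq_integral do rewrite EFinD.
have s0 (g : S -> R) x : (forall x, 0 <= g x) -> 0 <= bsum g L x.
  by move=> g0; apply: sumr_ge0 => k _.
rewrite ge0_integralZl//; last 2 first.
- by apply/measurable_EFinP; exact: mbs.
- by move=> x _; rewrite lee_fin; apply: s0 => ?; rewrite indicE.
rewrite ge0_integralD//; last 2 first.
- by move=> x _; rewrite lee_fin s0.
- by apply/measurable_EFinP; exact: mbs.
rewrite !integral_bsum//.
rewrite integral_indic// setIT integral_cst// => h.
rewrite -lee_fin -mulrA !EFinM -mEE; apply: (le_trans h).
by rewrite EFinD !EFinM; apply: leeD; rewrite lee_wpmul2l ?lee_fin.
Qed.

End InvariantMeasure.
End Tightness.

(** * Diagonal extraction *)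

Section Subsequence.
Variable R : realType.

Lemma pointwise_subsequence (T : countType) (u : nat -> T -> R) (B : R) :
  (forall n w, 0 <= u n w <= B) ->
  exists k : nat -> nat, {homo k : m n / (m < n)%N} /\
    exists p : T -> R, forall w, u (k n) w @[n --> \oo] --> p w.
Proof.
move=> uB.
have cK := @tychonoff T (fun=> R) (fun=> `[0, B]%classic) (fun=> @segment_compact R 0 B).
pose F : set_system {ptws T -> R} := (u : nat -> {ptws T -> R}) @ \oo.
have FK : F [set f | forall i, `[0, B]%classic (f i)].
  by exists 0%N => // n _ i /=; rewrite in_itv/=.
have [p [_ pF]] := cK F _ FK.
(* Tychonoff provides only a cluster point. As [T] is countable, it suffices to choose the [k]-th
   index in a neighbourhood controlling the first [k] elements up to [1 / (k + 1)]. *)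
pose Q k (f : {ptws T -> R}) := forall j, (j < k)%N ->
  if unpickle j is Some w then (`|f w - p w| < k.+1%:R^-1 : Prop) else True.
have nQ k : nbhs p (Q k).
  pose Q1 j (f : {ptws T -> R}) :=
    if unpickle j is Some w then (`|f w - p w| < k.+1%:R^-1 : Prop) else True.
  have nQ1 j : nbhs p (Q1 j).
    rewrite /Q1; case: unpickle => [w|]; last exact: filterT.
    have k0 : 0 < k.+1%:R^-1 :> R by rewrite invr_gt0 ltr0n.
    have h := @proj_continuous T (fun=> R) w p _ (nbhsx_ballx (p w) _ k0).
    apply: (@filterS _ (nbhs p) _ _ _ _ h) => f.
    rewrite -ball_normE /= distrC.
    by [].
  suff : forall n, nbhs p (fun f => forall j, (j < n)%N -> Q1 j f) by apply.
  elim=> [|n IH]; first by apply: filterS filterT.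
  apply: filterS2 IH (nQ1 n) => f h1 h2 j; rewrite ltnS leq_eqVlt.
  by move=> /predU1P[->//|]; exact: h1.
have freq k N : exists n, (N < n)%N /\ Q k (u n).
  have FN : F [set f | exists2 n, (N < n)%N & f = u n].
    by exists N.+1 => // n /= Nn; exists n.
  by have [f [[n Nn ->] Qf]] := pF _ _ FN (nQ k); exists n.
have /choice[next nextP] : forall kN : nat * nat, exists n, (kN.2 < n)%N /\ Q kN.1 (u n).
  by move=> [k N]; exact: freq.
pose fix sel n := if n is n'.+1 then next (n, sel n') else next (0, 0)%N.
exists sel; split.
  by apply: homo_ltn; [exact: ltn_trans|move=> n; have [] := nextP (n.+1, sel n)].
have selQ n : Q n (u (sel n)) by case: n => [|n]; [exact: (nextP (0, 0)%N).2|exact: (nextP (n.+1, sel n)).2].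
exists p => w; apply/cvgrPdist_lt => e e0.
near=> n.
have := selQ n (pickle w); rewrite pickleK distrC.
move=> h; apply: (lt_trans (h _)); first by near: n; exact: nbhs_infty_gt.
near: n; have [N NP] : exists N : nat, e^-1 < N%:R.
  by exists (Num.bound e^-1); apply: archi_boundP; rewrite invr_ge0 ltW.
exists N => // n /= Nn; rewrite -[e]invrK ltf_pV2 ?posrE ?invr_gt0//.
by apply: (lt_le_trans NP); rewrite ler_nat leqW.
Unshelve. all: by end_near. Qed.

End Subsequence.

(** * Measures with prescribed cylinder masses *)

Section IntervalTree.
Variables (R : realType) (mu : seq nat -> R).
Hypothesis mu_ge0 : forall w, 0 <= mu w.
Hypothesis mu_children : forall w, series (fun j => mu (rcons w j)) @ \oo --> mu w.

(* Words are laid out as nested intervals, [node w] having length [mu w]; the measure is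
   the image of Lebesgue measure under the map which reads off the intervals containing a
   given point. *)
Fixpoint left_end_from (l : R) (w s : seq nat) : R :=
  if s is j :: s' then
    left_end_from (l + series (fun i => mu (rcons w i)) j) (rcons w j) s'
  else l.

Definition left_end := left_end_from 0 [::].

Lemma left_end_from_rcons l w s j : left_end_from l w (rcons s j) =
  left_end_from l w s + series (fun i => mu (rcons (w ++ s) i)) j.
Proof.
elim: s l w => [|i s IH] l w /=; first by rewrite cats0.
by rewrite IH cat_rcons.
Qed.

Lemma left_end_rcons w j : left_end (rcons w j) =
  left_end w + series (fun i => mu (rcons w i)) j.
Proof. exact: left_end_from_rcons. Qed.

Definition node w : set R := `[left_end w, left_end w + mu w[%classic.

Let seriesS (u : nat -> R) n : series u n.+1 = series u n + u n.
Proof. by rewrite seriesEnat /= big_nat_recr. Qed.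

Let series_homo w : nondecreasing_seq (series (fun i => mu (rcons w i))).
Proof. by apply/nondecreasing_seqP => n; rewrite seriesS lerDl. Qed.

(** The lengths of the children add up to the length of the parent, so some partial sum exceeds the
    offset of [u]; the first one to do so selects the child. *)
Lemma node_cover w u : node w u -> exists j, node (rcons w j) u.
Proof.
rewrite /node /= in_itv/= => /andP[lu um].
have ex : exists n, u - left_end w < series (fun i => mu (rcons w i)) n.
  have e0 : 0 < mu w - (u - left_end w) by lra.
  have /cvgrPdist_lt /(_ _ e0)[n _ /(_ n (leqnn n))] := @mu_children w.
  by rewrite ltr_norml => /andP[_ h]; exists n; lra.
case: (ex_minnP ex) => -[|j] lt_j min_j.
  by move: lt_j; rewrite /series/= big_geq//; lra.
exists j; rewrite /= in_itv/= left_end_rcons -addrA -seriesS.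
apply/andP; split; last by lra.
rewrite addrC -lerBrDr leNgt; apply/negP => /min_j.
by rewrite ltnn.
Qed.

Lemma node_sub w j : node (rcons w j) `<=` node w.
Proof.
move=> u; rewrite /node /= !in_itv/= left_end_rcons -addrA -seriesS => /andP[h1 h2].
have s0 : 0 <= series (fun i => mu (rcons w i)) j.
  by rewrite /series/=; apply: sumr_ge0.
have sle : series (fun i => mu (rcons w i)) j.+1 <= mu w.
  rewrite -(cvg_lim _ (@mu_children w))//.
  apply: nondecreasing_cvgn_le; first exact: series_homo.
  by apply/cvg_ex; exists (mu w); exact: mu_children.
by apply/andP; split; lra.
Qed.

Lemma node_inj w i j u : node (rcons w i) u -> node (rcons w j) u -> i = j.
Proof.
wlog ij : i j / (i < j)%N.
  move=> W ui uj; have [ij|ij|//] := ltngtP i j; first exact: (W i j).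
  by apply/esym; exact: (W j i).
rewrite /node /= !in_itv/= !left_end_rcons -addrA -seriesS => /andP[_ h1] /andP[h2 _].
by exfalso; have := @series_homo w _ _ ij; lra.
Qed.

Definition child w u : nat := xget 0%N [set j | node (rcons w j) u].

Lemma childP w u : node w u -> node (rcons w (child w u)) u.
Proof.
move=> /node_cover[j jP]; rewrite /child.
by case: xgetP => [i -> //|/(_ j)].
Qed.

Lemma child_eq w j u : node (rcons w j) u -> child w u = j.
Proof.
move=> h; apply: (@node_inj w _ _ u) => //.
by apply: childP; exact: node_sub h.
Qed.

Fixpoint branch u n : seq nat :=
  if n is n'.+1 then rcons (branch u n') (child (branch u n') u) else [::].

Definition coding u n : nat := child (branch u n) u.

Lemma branchE u n : branch u n = mkseq (coding u) n.
Proof. by elim: n => [//|n IH]; rewrite mkseqS -IH. Qed.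

Lemma node_branch u n : node [::] u -> node (branch u n) u.
Proof. by move=> u0; elim: n => [//|n IH] /=; exact: childP. Qed.

Lemma branch_node u w : node w u -> branch u (size w) = w /\ node [::] u.
Proof.
elim/last_ind: w => [//|w j IH] h; have [bw n0] := IH (node_sub h).
by rewrite size_rcons /= bw (child_eq h).
Qed.

Variable A : transition.
Local Notation S := (cyl_space A).
Local Notation lam := (@lebesgue_measure R).
Hypothesis mu_inadmissible : forall w, @cylinder A w = set0 -> mu w = 0.

(** A half-open interval of length zero is empty, so a node containing a point has positive weight
    and its word is admissible. *)
Lemma node_cylinder w u : node w u -> exists x : Sigma A, cylinder w x.
Proof.
rewrite /node /= in_itv/= => /andP[h1 h2].
have /eqP/set0P : @cylinder A w <> set0 by move=> /mu_inadmissible w0; lra.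
by case=> x; exists x.
Qed.

Lemma coding_shift u : node [::] u -> shift_space A (coding u).
Proof.
move=> u0 i; have [x xP] := node_cylinder (node_branch i.+2 u0).
have h j : (j < i.+2)%N -> val x j = coding u j.
  by move=> ji; rewrite xP branchE ?size_mkseq// nth_mkseq.
by rewrite -!h//; exact: SigmaP.
Qed.

Definition coding_pt (u : measurableTypeR R) : S :=
  insubd (point : Sigma A) (coding u : {ptws nat -> nat}).

Lemma coding_ptP u w : node [::] u -> cylinder w (coding_pt u) <-> node w u.
Proof.
move=> u0; have vE : val (coding_pt u : Sigma A) = coding u :> (nat -> nat).
  by rewrite val_insubd ifT//; apply/mem_set/coding_shift.
split=> [cw|wu].
  suff -> : w = branch u (size w) by exact: node_branch.
  apply: (@eq_from_nth _ 0%N); rewrite branchE ?size_mkseq// => i iw.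
  by rewrite nth_mkseq// -vE cw.
move=> i iw; rewrite vE; have [bw _] := branch_node wu.
by rewrite -bw branchE nth_mkseq.
Qed.

Lemma measurable_node w : measurable (node w : set (measurableTypeR R)).
Proof. exact: measurable_itv. Qed.

Lemma lebesgue_node w : lam (node w) = (mu w)%:E.
Proof.
rewrite lebesgue_measure_itv/= lte_fin ltrDl.
have := mu_ge0 w; rewrite le_eqVlt => /predU1P[<-|->]; first by rewrite ltxx.
by congr (_%:E); lra.
Qed.

Lemma node_root w : node w `<=` node [::].
Proof. by move=> u /branch_node[]. Qed.

Lemma cylinder_measure : exists m : {finite_measure set S -> \bar R},
  forall w, m (cylinder w) = (mu w)%:E.
Proof.
pose X (u : measurableTypeR R) : S := if u \in node [::] then coding_pt u else point.
have mX : measurable_fun setT X.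
  apply: (@measurability _ _ (measurableTypeR R) S setT _ (range (@cylinder A))) => //.
  move=> _ [_ [w _ <-] <-]; rewrite setTI.
  (* Off the root interval [X] is constantly [point], which adds a second piece to the preimage;
     Lebesgue measure restricted to the root ignores it. *)
  have -> : X @^-1` cylinder w = node w `|`
      (~` node [::] `&` (if `[< @cylinder A w point >] then setT else set0)).
    apply/seteqP; split=> u; rewrite /X /=.
      case: ifPn => [/set_mem u0 /(coding_ptP _ u0)|/negP u0 wp]; first by left.
      by right; split; [move=> ?; apply: u0; exact: mem_set|rewrite ifT//; exact/asboolP].
    move=> [wu|[u0]].
      have u0 := node_root wu; rewrite mem_set//; exact/coding_ptP.
    by rewrite memNset//; case: ifPn => // /asboolP.
  apply: measurableU; first exact: measurable_node.
  apply: measurableI; first by apply: measurableC; exact: measurable_node.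
  by case: ifP => _; [exact: measurableT|exact: measurable0].
have [m0 m0E] := pushforward_measure (mrestr lam (measurable_node [::])) mX.
have m0w w : m0 (cylinder w) = (mu w)%:E.
  rewrite m0E -lebesgue_node; congr (lam _); apply/seteqP; split=> u /=.
    by move=> [+ u0]; rewrite /X mem_set// => /(coding_ptP _ u0).
  by move=> wu; have u0 := node_root wu; split => //; rewrite /X mem_set//; exact/coding_ptP.
have m0T : (m0 setT < +oo)%E.
  by rewrite -(@cylinder_nil A) m0w ltry.
have [m mE] := finite_measure_of m0T.
by exists m => w; rewrite mE.
Qed.

End IntervalTree.

(** * Suspension measures and convergence on cylinders *)

Lemma adde_cancelr (R : realDomainType) (u v z : \bar R) : z \is a fin_num ->
  (u + z = v + z)%E -> u = v.
Proof. by move=> zfin E; rewrite -[LHS](addeK u zfin) E addeK. Qed.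

Section SuspensionMeasure.
Variables (A : transition) (R : realType) (tau : roof A R).
Local Notation sigma := (@sigma A).
Local Notation S := (cyl_space A).
Local Notation Y := (borel_suspension tau).
Local Notation P := (S * measurableTypeR R)%type.
Local Notation lam := (@lebesgue_measure R).
Variables (m : {finite_measure set S -> \bar R}) (nu : {measure set Y -> \bar R}).
Hypothesis nuE : forall B : set Y, measurable B ->
  nu B = (m \x lam)%E (Y0 tau `&` pt tau @^-1` B).

Section FlowInvariance.
Hypothesis m_inv : forall C : set S, measurable C -> m (sigma @^-1` C) = m C.

Let hits (B : set Y) (x : S) : set (measurableTypeR R) :=
  [set s | 0 <= s /\ B (path_pt tau x s)].

Let measurable_hits B x : measurable B -> measurable (hits B x).
Proof.
move=> mB; have := measurable_xsection x (measurable_path_pt mB).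
congr (measurable _); apply/seteqP.
by split=> s; [move=> /xsectionP|move=> ?; apply/xsectionP].
Qed.

Let measurable_window (B : set Y) (t : R) : measurable B ->
  measurable_fun setT (fun x : S => lam (`[0%R, t[%classic `&` hits B x)).
Proof.
move=> mB.
have mE : measurable ((setT `*` `[0, t[%classic) `&`
    [set p | 0 <= p.2 /\ B (path_pt tau p.1 p.2)] : set P).
  apply: measurableI; last exact: measurable_path_pt.
  by apply: measurableX => //; exact: measurable_itv.
have := @measurable_fun_xsection _ _ S (measurableTypeR R) R lam _ mE.
congr (measurable_fun _ _); apply/funext => x /=; congr (lam _).
by apply/seteqP; split=> s; [move=> /xsectionP[[_ ?] ?]|move=> [? ?]; apply/xsectionP].
Qed.

(** The time spent in [B] during [[0, tau x[] and during [[t, t + tau x[] differ by the coboundary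
    [e x - e (sigma x)]. As [e] is bounded by [t] and [m] is finite and invariant, its integral
    vanishes. *)
Lemma suspension_invariant : flow_invariant nu.
Proof.
move=> t t0 B mB.
have mF : measurable (flow t @^-1` B : set Y).
  rewrite -[X in measurable X]setTI.
  exact: (@measurable_flow A R tau t t0 measurableT B mB).
have mItv (a b : R) : measurable (`[a, b[%classic : set (measurableTypeR R)).
  exact: measurable_itv.
pose a (x : S) := lam (`[0, tau x[%classic `&` hits B x).
pose b (x : S) := lam (`[t, t + tau x[%classic `&` hits B x).
pose e (x : S) := lam (`[0, t[%classic `&` hits B x).
have nuB : nu B = (\int[m]_x a x)%E.
  rewrite nuE//; apply: eq_integral => x _ /=; congr (lam _).
  apply/seteqP; split=> s.
    move=> /xsectionP[/andP[/= s0 st] Bs]; rewrite /= in_itv/= s0 st; split => //.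
    by split => //; rewrite path_pt_lt// s0 ltW.
  rewrite /= in_itv/= => -[/andP[s0 st] [_ Bs]]; apply/xsectionP; split.
    by rewrite /Y0/= s0.
  by move: Bs; rewrite path_pt_lt// s0 ltW.
have nuF : nu (flow t @^-1` B) = (\int[m]_x b x)%E.
  rewrite nuE//; apply: eq_integral => x _ /=.
  rewrite /b -[RHS](lebesgue_measure_shift t); last first.
    by apply: measurableI => //; exact: measurable_hits.
  congr (lam _); apply/seteqP; split=> s.
    move=> /xsectionP[/andP[/= s0 st] Bs]; rewrite /= in_itv/=.
    split; first by apply/andP; split; lra.
    split; first exact: addr_ge0.
    by move: Bs; rewrite flow_path// s0 ltW.
  rewrite /= in_itv/= => -[/andP[h1 h2] [_ Bs]].
  have s0 : 0 <= s by lra.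
  have st : s < tau x by lra.
  apply/xsectionP; split; first by rewrite /Y0/= s0.
  by rewrite /= /pt/= flow_path// s0 ltW.
(* Both sides measure the times in [0, t + tau x[ at which the orbit of (x, 0) is in B. *)
have abe x : (a x + e (sigma x) = b x + e x)%E.
  have tx := roof_gt0 tau x.
  transitivity (lam (`[0, t + tau x[%classic `&` hits B x)); last first.
    rewrite (_ : `[0, t + tau x[%classic = `[t, t + tau x[%classic `|` `[0, t[%classic :> set R).
      rewrite setIUl measureU//; try by apply: measurableI => //; exact: measurable_hits.
      apply/seteqP; split=> s //= -[[+ _] [+ _]]; rewrite !in_itv/=.
      by move=> /andP[h _] /andP[_]; rewrite ltNge h.
    apply/seteqP; split=> s /=; rewrite !in_itv/=.
      by move=> /andP[s0 st]; have [h|h] := leP t s; [left|right]; rewrite ?s0 ?st.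
    by move=> [|] /andP[h1 h2]; apply/andP; split; lra.
  have -> : e (sigma x) = lam (`[tau x, t + tau x[%classic `&` hits B x).
    rewrite -[RHS](lebesgue_measure_shift (tau x)); last first.
      by apply: measurableI => //; exact: measurable_hits.
    congr (lam _); apply/seteqP; split=> s /=; rewrite !in_itv/=.
      move=> [/andP[s0 st] [_ Bs]]; split; first by apply/andP; split; lra.
      by split; [lra|rewrite addrC path_pt_top].
    move=> [/andP[h1 h2] [_ Bs]]; have s0 : 0 <= s by lra.
    split; first by apply/andP; split; lra.
    by split => //; move: Bs; rewrite addrC path_pt_top.
  rewrite (_ : `[0, t + tau x[%classic = `[0, tau x[%classic `|` `[tau x, t + tau x[%classic :> set R).
    rewrite setIUl measureU//; try by apply: measurableI => //; exact: measurable_hits.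
    apply/seteqP; split=> s //= -[[+ _] [+ _]]; rewrite !in_itv/=.
    by move=> /andP[_ h] /andP[h' _]; lra.
  apply/seteqP; split=> s /=; rewrite !in_itv/=.
    by move=> /andP[s0 st]; have [h|h] := ltP s (tau x); [left|right]; rewrite ?s0 ?st.
  by move=> [|] /andP[h1 h2]; apply/andP; split; lra.
have me : measurable_fun setT e by exact: measurable_window.
have ma : measurable_fun setT a.
  have mE : measurable (Y0 tau `&` [set p | 0 <= p.2 /\ B (path_pt tau p.1 p.2)] : set P).
    by apply: measurableI; [exact: measurable_Y0|exact: measurable_path_pt].
  have := @measurable_fun_xsection _ _ S (measurableTypeR R) R lam _ mE.
  congr (measurable_fun _ _); apply/funext => x /=; congr (lam _).
  apply/seteqP; split=> s; [move=> /xsectionP[/andP[/= ? ?] ?]|move=> [+ ?]].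
    by split => //=; rewrite in_itv/=; apply/andP.
  by rewrite /= in_itv/= => /andP[? ?]; apply/xsectionP; split => //; apply/andP.
have mb : measurable_fun setT b.
  have mE : measurable ([set p | t <= p.2 < t + tau p.1] `&` [set p | 0 <= p.2 /\ B (path_pt tau p.1 p.2)] : set P).
    apply: measurableI; last exact: measurable_path_pt.
    have -> : [set p | t <= p.2 < t + tau p.1] =
       (fun p : P => (t <= p.2) && (p.2 < t + tau p.1)) @^-1` [set true].
      by apply/seteqP; split.
    rewrite -[X in measurable X]setTI.
    suff : measurable_fun setT (fun p : P => (t <= p.2) && (p.2 < t + tau p.1)) by apply.
    apply: measurable_and.
      by apply: measurable_fun_ler; [exact: measurable_cst|exact: measurable_snd].
    apply: measurable_fun_ltr; first exact: measurable_snd.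
    apply: measurable_funD; first exact: measurable_cst.
    exact: (measurableT_comp (measurable_roof tau) measurable_fst).
  have := @measurable_fun_xsection _ _ S (measurableTypeR R) R lam _ mE.
  congr (measurable_fun _ _); apply/funext => x /=; congr (lam _).
  apply/seteqP; split=> s; [move=> /xsectionP[/andP[/= ? ?] ?]|move=> [+ ?]].
    by split => //=; rewrite in_itv/=; apply/andP.
  by rewrite /= in_itv/= => /andP[? ?]; apply/xsectionP; split => //; apply/andP.
have mes : measurable_fun setT (fun x : S => e (sigma x)).
  exact: (measurableT_comp me (@measurable_sigma A)).
have eoo : (\int[m]_x e x < +oo)%E.
  apply: (@le_lt_trans _ _ (\int[m]_x cst t%:E x)%E).
    apply: ge0_le_integral => //.
    move=> x _; apply: (@le_trans _ _ (lam `[0, t[%classic)).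
      apply: le_measure; rewrite ?inE; [|exact: mItv|exact: subIsetl].
      by apply: measurableI => //; exact: measurable_hits.
    rewrite lebesgue_measure_itv/= lte_fin; case: ifP => _; last by rewrite lee_fin.
    by rewrite oppr0 adde0.
  rewrite integral_cst// lte_mul_pinfty// ?lee_fin//.
  by rewrite ltey_eq fin_num_measure.
have efin : (\int[m]_x e x)%E \is a fin_num.
  by rewrite ge0_fin_numE//; apply: integral_ge0.
rewrite nuB nuF.
have : (\int[m]_x (a x + e (sigma x)) = \int[m]_x (b x + e x))%E.
  by apply: eq_integral => x _.
have a0 x : (0 <= a x)%E by exact: measure_ge0.
have b0 x : (0 <= b x)%E by exact: measure_ge0.
have e0 x : (0 <= e x)%E by exact: measure_ge0.
rewrite (ge0_integralD m measurableT (fun x _ => a0 x) ma (fun x _ => e0 (sigma x)) mes).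
rewrite (ge0_integralD m measurableT (fun x _ => b0 x) mb (fun x _ => e0 x) me).
rewrite (integral_sigma m_inv me e0).
by move=> E; exact/esym/(adde_cancelr efin E).
Qed.

End FlowInvariance.

(** The length of the part of the fiber of [x] lying in [[a, b]]. The roof may be unbounded, but
    this length is bounded in terms of [b] and is 1-Lipschitz in [tau x]. *)
Definition clip (a b : R) (x : Sigma A) : R :=
  Num.max 0 (Num.min b (tau x) - Num.max a 0).

Lemma clip_lebesgue a b x :
  lam (`[a, b]%classic `&` `[0, tau x[%classic) = (clip a b x)%:E.
Proof.
have t0 := roof_gt0 tau x; rewrite /clip.
have [bt|tb] := ltP b (tau x).
  have -> : `[a, b]%classic `&` `[0, tau x[%classic = `[Num.max a 0, b]%classic :> set R.
    apply/seteqP; split=> s /=; rewrite !in_itv/= ge_max.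
      by move=> [/andP[-> ->] /andP[-> _]].
    by move=> /andP[/andP[-> ->] sb]; rewrite sb (le_lt_trans sb).
  rewrite lebesgue_measure_itv/= lte_fin; case: ltP => h.
    by rewrite -EFinD; congr (_%:E); apply/esym/max_idPr; rewrite subr_ge0 ltW.
  by congr (_%:E); apply/esym/max_idPl; rewrite subr_le0.
have -> : `[a, b]%classic `&` `[0, tau x[%classic = `[Num.max a 0, tau x[%classic :> set R.
  apply/seteqP; split=> s /=; rewrite !in_itv/= ge_max.
    by move=> [/andP[-> _] /andP[-> ->]].
  by move=> /andP[/andP[-> ->] st]; rewrite st; split => //; rewrite (ltW (lt_le_trans st tb)).
rewrite lebesgue_measure_itv/= lte_fin; case: ltP => h.
  by rewrite -EFinD; congr (_%:E); apply/esym/max_idPr; rewrite subr_ge0 ltW.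
by congr (_%:E); apply/esym/max_idPl; rewrite subr_le0.
Qed.

Lemma clip_ge0 a b x : 0 <= clip a b x.
Proof. by rewrite /clip le_max lexx. Qed.

Lemma clip_le a b x : clip a b x <= Num.max 0 b.
Proof.
rewrite /clip ge_max !le_max lexx/=; apply/orP; right.
apply: (@le_trans _ _ (Num.min b (tau x))); last by rewrite ge_min lexx.
by rewrite lerBlDr lerDl le_max lexx orbT.
Qed.

Lemma clip_lipschitz a b x y : `|clip a b x - clip a b y| <= `|tau x - tau y|.
Proof.
rewrite /clip ler_norml.
have := ler_norm (tau x - tau y); have := ler_norm (- (tau x - tau y)); rewrite normrN.
set n := `|_|; set p := Num.max a 0 => h1 h2.
by rewrite /Num.max /Num.min; repeat case: ifPn; rewrite -?leNgt; move=> *; apply/andP; split; lra.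
Qed.

Lemma measurable_clip a b : measurable_fun setT (clip a b : S -> R).
Proof.
apply: measurable_maxr; first exact: measurable_cst.
apply: measurable_funB; last exact: measurable_cst.
by apply: measurable_minr; [exact: measurable_cst|exact: measurable_roof].
Qed.

Lemma box_coords w a b :
  box (tau := tau) (cylinder w) a b = @coords A R tau @^-1` (cylinder w `*` `[a, b]%classic).
Proof.
apply/seteqP; split=> y /=.
  by move=> [x [t [wx tab Yt ->]]]; rewrite coords_lt//= in_itv/=.
rewrite in_itv/= => -[wx tab]; exists (coords y).1, (coords y).2.
by split => //; [exact: coords_Y0|rewrite -[LHS]coordsK].
Qed.

Lemma measure_box w a b :
  nu (box (cylinder w) a b) = (\int[m]_(x in cylinder w) (clip a b x)%:E)%E.
Proof.
have mB : measurable (box (cylinder w) a b : set Y).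
  rewrite box_coords -[X in measurable X]setTI.
  apply: (@measurable_coords A R tau measurableT (cylinder w `*` `[a, b])).
  by apply: measurableX; [exact: measurable_cylinder|exact: measurable_itv].
rewrite nuE// [RHS]integral_mkcond; apply: eq_integral => x _ /=.
rewrite /patch; case: ifPn => [/set_mem wx|/negP nwx].
  rewrite -clip_lebesgue; congr (lam _); apply/seteqP; split=> s.
    move=> /xsectionP[Yxs]; rewrite /= box_coords /= /pt/= coords_lt//= => -[_ ?].
    by split => //; rewrite in_itv/=; exact: Yxs.
  move=> [/= sab st]; have Yxs : Y0 tau (x, s) by move: st; rewrite in_itv.
  by apply/xsectionP; split => //; rewrite /= box_coords /= /pt/= coords_lt.
rewrite (_ : xsection _ _ = set0) ?measure0//; apply/seteqP; split=> s //.
move=> /xsectionP[Yxs]; rewrite /= box_coords /= /pt/= coords_lt//= => -[wx _].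
by apply: nwx; exact: mem_set.
Qed.

End SuspensionMeasure.

(** * Convergence of integrals over cylinders *)

Section CylinderIntegrals.
Variables (A : transition) (R : realType).
Local Notation S := (cyl_space A).
Implicit Types (m : {finite_measure set S -> \bar R}) (h g : S -> R).

Definition cyl_int m h (w : seq nat) : R :=
  fine (\int[m]_(x in cylinder w) (h x)%:E)%E.

Lemma cyl_intE m h w (B : R) : measurable_fun setT h -> (forall x, 0 <= h x <= B) ->
  (\int[m]_(x in cylinder w) (h x)%:E)%E = (cyl_int m h w)%:E.
Proof.
move=> mh hB; rewrite /cyl_int fineK// ge0_fin_numE//; last first.
  by apply: integral_ge0 => x _; rewrite lee_fin; case/andP: (hB x).
apply: (@le_lt_trans _ _ (\int[m]_(x in cylinder w) cst B%:E x)%E).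
  apply: ge0_le_integral => //; first exact: measurable_cylinder.
  - by move=> x _; rewrite lee_fin; case/andP: (hB x).
  - by apply/measurable_EFinP; exact: measurable_funTS.
  - by move=> x _; rewrite lee_fin; case/andP: (hB x).
rewrite integral_cst; last exact: measurable_cylinder.
have B0 : 0 <= B by case/andP: (hB point); exact: le_trans.
rewrite lte_mul_pinfty ?lee_fin// ltey_eq fin_num_measure//.
exact: measurable_cylinder.
Qed.

Lemma cyl_int_ge0 m h w : (forall x, 0 <= h x) -> 0 <= cyl_int m h w.
Proof.
by move=> h0; apply/fine_ge0/integral_ge0 => x _; rewrite lee_fin.
Qed.

Lemma cyl_int_children m h w (B : R) : measurable_fun setT h ->
  (forall x, 0 <= h x <= B) ->
  series (fun j => cyl_int m h (rcons w j)) @ \oo --> cyl_int m h w.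
Proof.
move=> mh hB; have h0 x : 0 <= h x by case/andP: (hB x).
pose u j := (\int[m]_(x in cylinder (rcons w j)) (h x)%:E)%E.
have u0 j : (0 <= u j)%E by apply: integral_ge0 => x _; rewrite lee_fin.
have uE : (\sum_(0 <= j <oo) u j)%E = (cyl_int m h w)%:E.
  rewrite -(cyl_intE _ _ mh hB) cylinder_split; apply/esym/ge0_integral_bigcup.
  - by move=> j; exact: measurable_cylinder.
  - by apply/measurable_EFinP; exact: measurable_funTS.
  - by move=> x _; rewrite lee_fin.
  - exact: trivIset_cylinder.
have cu : (fun n => \sum_(0 <= j < n) u j)%E @ \oo --> (cyl_int m h w)%:E.
  by rewrite -uE; apply: is_cvg_nneseries => j _ _.
apply: cvg_trans (fine_cvg cu); apply: near_eq_cvg; near=> n.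
rewrite /series /= (eq_bigr (fun j => (cyl_int m h (rcons w j))%:E)) ?sumEFin//.
by move=> j _; exact: (cyl_intE _ _ mh hB).
Unshelve. all: by end_near. Qed.

Lemma cyl_int_le m h g w (B : R) : measurable_fun setT h -> measurable_fun setT g ->
  (forall x, 0 <= h x <= B) -> (forall x, 0 <= g x <= B) ->
  (forall x, cylinder w x -> h x <= g x) -> cyl_int m h w <= cyl_int m g w.
Proof.
move=> mh mg hB gB hg; rewrite -lee_fin -(cyl_intE _ _ mh hB) -(cyl_intE _ _ mg gB).
apply: ge0_le_integral => //; first exact: measurable_cylinder.
- by move=> x _; rewrite lee_fin; case/andP: (hB x).
- by apply/measurable_EFinP; exact: measurable_funTS.
- by apply/measurable_EFinP; exact: measurable_funTS.
Qed.

Lemma cyl_int_cst m (c : R) w : cyl_int m (cst c) w = c * fine (m (cylinder w)).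
Proof.
rewrite /cyl_int -[X in fine X]/(\int[m]_(x in cylinder w) cst c%:E x)%E.
rewrite integral_cst; last exact: measurable_cylinder.
by rewrite fineM// fin_num_measure//; exact: measurable_cylinder.
Qed.

Lemma cyl_intD m h g w (B C : R) : measurable_fun setT h -> measurable_fun setT g ->
  (forall x, 0 <= h x <= B) -> (forall x, 0 <= g x <= C) ->
  cyl_int m (h \+ g) w = cyl_int m h w + cyl_int m g w.
Proof.
move=> mh mg hB gC; apply: EFin_inj.
rewrite EFinD -(cyl_intE _ _ mh hB) -(cyl_intE _ _ mg gC).
rewrite -(@cyl_intE _ _ _ (B + C)); last 2 first.
- exact: measurable_funD.
- by move=> x /=; case/andP: (hB x) => ? ?; case/andP: (gC x) => ? ?; rewrite addr_ge0// lerD.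
rewrite -ge0_integralD//; first exact: measurable_cylinder.
- by move=> x _; rewrite lee_fin; case/andP: (hB x).
- by apply/measurable_EFinP; exact: measurable_funTS.
- by move=> x _; rewrite lee_fin; case/andP: (gC x).
- by apply/measurable_EFinP; exact: measurable_funTS.
Qed.

Lemma cyl_int_partial m h w (B : R) J : measurable_fun setT h ->
  (forall x, 0 <= h x <= B) ->
  \sum_(0 <= j < J) cyl_int m h (rcons w j) <= cyl_int m h w.
Proof.
move=> mh hB; have h0 x : 0 <= h x by case/andP: (hB x).
have cv := @cyl_int_children m h w B mh hB.
rewrite -(cvg_lim _ cv)//; apply: nondecreasing_cvgn_le.
  apply/nondecreasing_seqP => n; rewrite /series/= big_nat_recr//= lerDl.
  exact: cyl_int_ge0.
by apply/cvg_ex; exists (cyl_int m h w).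
Qed.

Section CylinderConvergence.
Variables (mn : nat -> {finite_measure set S -> \bar R}).
Variables (m : {finite_measure set S -> \bar R}) (C0 : R).
Hypothesis mn_cvg : forall w, w <> [::] ->
  fine (mn n (cylinder w)) @[n --> \oo] --> fine (m (cylinder w)).
Hypothesis mn_le : forall n w, fine (mn n (cylinder w)) <= C0.

Section Lsc.
Variables (h : S -> R) (B : R).
Hypotheses (mh : measurable_fun setT h) (hB : forall x, 0 <= h x <= B).

(* Fatou's lemma along the tree of cylinders below [w]: at depth [k], [h] is constant up
   to [e]. *)
Let cyl_int_lsc_eps (e : R) k : 0 < e ->
  (forall x y : Sigma A, agree k x y -> `|h x - h y| <= e) ->
  forall d w, w <> [::] -> (k <= size w + d)%N -> forall eta, 0 < eta ->
  \forall n \near \oo, cyl_int m h w <= cyl_int (mn n) (h \+ cst (2 * e)) w + eta.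
Proof.
move=> e0 hk; have h0 x : 0 <= h x by case/andP: (hB x).
have mh2 : measurable_fun setT (h \+ cst (2 * e)).
  by apply: measurable_funD => //; exact: measurable_cst.
have hB2 x : 0 <= (h \+ cst (2 * e)) x <= B + 2 * e.
  by case/andP: (hB x) => h1 h2 /=; apply/andP; split; lra.
have B0 : 0 <= B by case/andP: (hB point); exact: le_trans.
elim=> [|d IH] w w0 kw eta eta0.
  rewrite addn0 in kw.
  (* At depth [k] the function oscillates by at most [e], so the constant [h z + e] fits between [h]
     and [h + 2 * e]; on an empty cylinder 0 serves. *)
  have [c /andP[c0 cB] cP] : exists2 c, 0 <= c <= B + 2 * e &
      forall x, cylinder w x -> h x <= c <= h x + 2 * e.
    have [[z wz]|nz] := pselect (exists z, @cylinder A w z); last first.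
      by exists 0; [apply/andP; split; lra|move=> x wx; exfalso; apply: nz; exists x].
    exists (h z + e) => [|x wx]; first by case/andP: (hB z) => ? ?; apply/andP; split; lra.
    have := hk _ _ (agree_le kw (cylinder_agree wz wx)).
    by rewrite ler_norml => /andP[? ?]; apply/andP; split; lra.
  have cB' (x : S) : 0 <= cst c x <= B + 2 * e by rewrite /= c0.
  have hB' x : 0 <= h x <= B + 2 * e by case/andP: (hB x) => ? ?; apply/andP; split; lra.
  have hc : cyl_int m h w <= c * fine (m (cylinder w)).
    rewrite -cyl_int_cst; apply: (@cyl_int_le m h (cst c) w (B + 2 * e) mh (measurable_cst _) hB' cB').
    by move=> x /cP /andP[].
  have cc : c * fine (mn n (cylinder w)) @[n --> \oo] --> c * fine (m (cylinder w)).
    by apply: cvgMr; exact: mn_cvg.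
  have /cvgrPdist_le /(_ _ eta0) := cc.
  apply: filterS => n; rewrite ler_norml => /andP[_ h1].
  have h2 : c * fine (mn n (cylinder w)) <= cyl_int (mn n) (h \+ cst (2 * e)) w.
    rewrite -cyl_int_cst; apply: (@cyl_int_le (mn n) (cst c) _ w (B + 2 * e) (measurable_cst _) mh2 cB' hB2).
    by move=> x /cP /andP[].
  by lra.
have e2 : 0 < eta / 2 by lra.
(* Finitely many children carry the integral against [m] up to [eta / 2]; only these need the
   induction hypothesis, and the others contribute nonnegatively for [mn n]. *)
have /cvgrPdist_le /(_ _ e2)[J _ /(_ J (leqnn J))] := @cyl_int_children m h w B mh hB.
rewrite ler_norml /series/= => /andP[_ hJ].
have part K et : 0 < et -> \forall n \near \oo,
    \sum_(0 <= j < K) cyl_int m h (rcons w j) <=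
    \sum_(0 <= j < K) cyl_int (mn n) (h \+ cst (2 * e)) (rcons w j) + et.
  elim: K et => [|K IHK] et et0.
    by apply: nearW => n; rewrite !big_geq//; lra.
  have et2 : 0 < et / 2 by lra.
  have wK : rcons w K <> [::] by case: (w).
  have kK : (k <= size (rcons w K) + d)%N by rewrite size_rcons addSnnS.
  apply: filterS2 (IHK _ et2) (IH _ wK kK _ et2) => n h1 h2.
  by rewrite !big_nat_recr//=; lra.
apply: filterS (part J _ e2) => n hn.
have := @cyl_int_partial (mn n) _ w _ J mh2 hB2; lra.
Qed.

Lemma cyl_int_lsc w (eta : R) :
  (forall e, 0 < e -> exists k, forall x y : Sigma A, agree k x y -> `|h x - h y| <= e) ->
  w <> [::] -> 0 < eta ->
  \forall n \near \oo, cyl_int m h w <= cyl_int (mn n) h w + eta.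
Proof.
move=> hu w0 eta0.
have C00 : 0 <= C0 by apply: le_trans (mn_le 0 [::]); exact: fine_ge0.
(* Raising the integrand by [2 * e] costs at most [2 * e * (C0 + 1) = eta / 2]; adding 1 keeps the
   denominator nonzero. *)
pose e := eta / (4 * (C0 + 1)).
have e0 : 0 < e by rewrite divr_gt0//; lra.
have [k hk] := hu _ e0.
have eta2 : 0 < eta / 2 by lra.
have := @cyl_int_lsc_eps e k e0 hk k w w0 (leq_addl _ _) _ eta2.
apply: filterS => n.
rewrite (@cyl_intD (mn n) h (cst (2 * e)) w B (2 * e) mh (measurable_cst _) hB); last first.
  by move=> x /=; rewrite lexx andbT; lra.
rewrite cyl_int_cst => hn.
have : 2 * e * fine (mn n (cylinder w)) <= eta / 2.
  apply: (@le_trans _ _ (2 * e * (C0 + 1))).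
    rewrite ler_pM2l; last by lra.
    by apply: (le_trans (mn_le n w)); lra.
  have C1 : C0 + 1 != 0 by rewrite gt_eqF// ltr_wpDl.
  by rewrite /e le_eqVlt; apply/orP; left; apply/eqP; field.
by lra.
Qed.

End Lsc.

(** Lower semicontinuity holds for [h] and for [B - h], whose integrals add up to [B] times a
    convergent mass; together they bound the integral from both sides. *)
Lemma cyl_int_cvg (h : S -> R) (B : R) w : measurable_fun setT h ->
  (forall x, 0 <= h x <= B) ->
  (forall e, 0 < e -> exists k, forall x y : Sigma A, agree k x y -> `|h x - h y| <= e) ->
  w <> [::] -> cyl_int (mn n) h w @[n --> \oo] --> cyl_int m h w.
Proof.
move=> mh hB hu w0.
have mg : measurable_fun setT (fun x => B - h x).
  by apply: measurable_funB => //; exact: measurable_cst.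
have gB x : 0 <= B - h x <= B by case/andP: (hB x) => ? ?; apply/andP; split; lra.
have gu e : 0 < e -> exists k, forall x y : Sigma A, agree k x y -> `|(B - h x) - (B - h y)| <= e.
  move=> /hu[k hk]; exists k => x y /hk; rewrite !ler_norml => /andP[? ?].
  by apply/andP; split; lra.
have sum m' : B * fine (m' (cylinder w)) = cyl_int m' h w + cyl_int m' (fun x => B - h x) w.
  rewrite -(@cyl_intD m' h _ w B B mh mg hB gB) -cyl_int_cst /cyl_int; congr (fine _).
  by apply: eq_integral => x _ /=; rewrite addrC subrK.
apply/cvgrPdist_le => e e0; have e2 : 0 < e / 2 by lra.
have cB : B * fine (mn n (cylinder w)) @[n --> \oo] --> B * fine (m (cylinder w)).
  by apply: cvgMr; exact: mn_cvg.
have /cvgrPdist_le /(_ _ e2) nB := cB.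
apply: filterS3 nB (cyl_int_lsc mh hB hu w0 e2) (cyl_int_lsc mg gB gu w0 e2) => n.
rewrite !sum ler_norml => /andP[h1 h2] h3 h4.
by rewrite ler_norml; apply/andP; split; lra.
Qed.

End CylinderConvergence.
End CylinderIntegrals.

(** * The limit measure on the shift *)

Section LimitMeasure.
Variables (A : transition) (R : realType).
Local Notation sigma := (@sigma A).
Local Notation S := (cyl_space A).

Definition fan (i J : nat) : set S := [set x : Sigma A | val x 0%N = i /\ (J <= val x 1)%N].

Lemma measurable_fan i J : measurable (fan i J).
Proof.
apply: open_measurable_cyl.
have -> : fan i J = [set x : Sigma A | [set i] (val x 0%N)] `&`
    [set x : Sigma A | [set j | (J <= j)%N] (val x 1)] by [].
by apply: openI; exact: open_coord.
Qed.

Variables (mn : nat -> {finite_measure set S -> \bar R}) (p : seq nat -> R).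
Hypothesis mn_inv : forall n (C : set S), measurable C ->
  mn n (sigma @^-1` C) = mn n C.
Hypothesis mn_cvg : forall w, fine (mn n (cylinder w)) @[n --> \oo] --> p w.
Hypothesis mn_tight : forall i e, 0 < e ->
  exists J, forall n, fine (mn n (fan i J)) <= e.

Let mcyl w : measurable (cylinder w : set S).
Proof. exact: measurable_cylinder. Qed.

Let fineE n (C : set S) : measurable C -> mn n C = (fine (mn n C))%:E.
Proof. by move=> mC; rewrite fineK// fin_num_measure. Qed.

Let p_ge0 w : 0 <= p w.
Proof.
rewrite -(cvg_lim _ (mn_cvg (w := w)))//; apply: limr_ge.
  by apply/cvg_ex; exists (p w); exact: mn_cvg.
by apply: nearW => n; exact: fine_ge0.
Qed.

Lemma sum_weights_cvg (f : nat -> seq nat) J :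
  \sum_(0 <= j < J) fine (mn n (cylinder (f j))) @[n --> \oo] --> \sum_(0 <= j < J) p (f j).
Proof.
elim: J => [|J IH].
  by rewrite big_geq//; apply: cvg_near_cst; apply: nearW => n; rewrite big_geq.
rewrite big_nat_recr//=; under eq_fun do rewrite big_nat_recr//=.
by apply: cvgD => //; exact: mn_cvg.
Qed.

Let iter_inv n k (C : set S) : measurable C -> mn n (iter k sigma @^-1` C) = mn n C.
Proof.
move=> mC; elim: k => [//|k IH].
rewrite -[RHS]IH -(mn_inv n (C := iter k sigma @^-1` C)).
  by congr (mn n _); apply/seteqP; split=> x; rewrite /preimage/= -iterS iterSr.
by rewrite -[X in measurable X]setTI; exact: measurable_iter_sigma.
Qed.

Let tail n w J : fine (mn n (cylinder w)) =
  \sum_(0 <= j < J) fine (mn n (cylinder (rcons w j))) +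
  fine (mn n (cylinder w `&` [set x : Sigma A | (J <= val x (size w))%N])).
Proof.
have mT K : measurable (cylinder w `&` [set x : Sigma A | (K <= val x (size w))%N] : set S).
  apply: measurableI => //; apply: open_measurable_cyl.
  exact: (@open_coord A (size w) [set j | (K <= j)%N]).
elim: J => [|J IH].
  by rewrite big_geq// add0r; congr (fine (mn n _)); apply/seteqP; split=> x; [|case].
rewrite big_nat_recr//= -addrA IH; congr (_ + _); apply: EFin_inj.
rewrite EFinD -!fineE// -measureU//.
  congr (mn n _); apply/seteqP; split=> x /=.
    move=> [wx]; rewrite leq_eqVlt => /predU1P[->|h]; last by right.
    by left; apply/cylinder_rcons.
  by move=> [/cylinder_rcons[wx ->]//|[wx /ltnW]].
apply/seteqP; split=> // x [/cylinder_rcons[_ <-]] [_ /=].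
by rewrite ltnn.
Qed.

(** By invariance the last letter [i] can be moved to time zero, so a tightness bound for single
    symbols controls the tail below every word ending in [i]. *)
Let tail_fan n w i J :
  fine (mn n (cylinder (rcons w i) `&`
    [set x : Sigma A | (J <= val x (size (rcons w i)))%N])) <= fine (mn n (fan i J)).
Proof.
have mT : measurable (cylinder (rcons w i) `&`
    [set x : Sigma A | (J <= val x (size (rcons w i)))%N] : set S).
  apply: measurableI => //; apply: open_measurable_cyl.
  exact: (@open_coord A _ [set j | (J <= j)%N]).
have mI : measurable (iter (size w) sigma @^-1` fan i J : set S).
  rewrite -[X in measurable X]setTI; apply: measurable_iter_sigma => //.
  exact: measurable_fan.
rewrite -(iter_inv n (size w) (measurable_fan i J)).
apply: fine_le; rewrite ?fin_num_measure//.
apply: le_measure; rewrite ?inE//.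
move=> x [/cylinder_rcons[_ xi]]; rewrite /= size_rcons => xJ.
by rewrite /fan /= !iter_sigmaE addn0 addn1.
Qed.

Lemma weights_children w : w <> [::] ->
  series (fun j => p (rcons w j)) @ \oo --> p w.
Proof.
elim/last_ind: w => [//|w i _ _]; apply/cvgrPdist_le => e e0.
have [J0 hJ0] := mn_tight i e0.
exists J0 => // J /= J0J.
have cv : fine (mn n (cylinder (rcons w i))) -
    \sum_(0 <= j < J) fine (mn n (cylinder (rcons (rcons w i) j))) @[n --> \oo] -->
    p (rcons w i) - \sum_(0 <= j < J) p (rcons (rcons w i) j).
  have sw := @sum_weights_cvg (fun j => rcons (rcons w i) j) J.
  exact: (cvgB (mn_cvg (w := rcons w i)) sw).
have bd n : 0 <= fine (mn n (cylinder (rcons w i))) -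
    \sum_(0 <= j < J) fine (mn n (cylinder (rcons (rcons w i) j))) <= e.
  rewrite (tail n _ J) [X in X - _]addrC addrK fine_ge0//=.
  apply: (le_trans (tail_fan n w i J)); apply: le_trans (hJ0 n).
  apply: fine_le; rewrite ?fin_num_measure//; try exact: measurable_fan.
  apply: le_measure; rewrite ?inE; try exact: measurable_fan.
  by move=> x [xi xJ]; split => //; exact: leq_trans xJ.
rewrite /series/= ger0_norm.
  apply: (ler_cvg_to cv (cvg_cst e)).
  by apply: nearW => n; case/andP: (bd n).
apply: (ler_cvg_to (cvg_cst 0) cv).
by apply: nearW => n; case/andP: (bd n).
Qed.

Variables (C0 : R).
Hypothesis mn_le : forall n, (mn n setT <= C0%:E)%E.

Lemma sum_root_le J : \sum_(0 <= j < J) p [:: j] <= C0.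
Proof.
apply: (ler_cvg_to (@sum_weights_cvg (fun j => [:: j]) J) (cvg_cst C0)).
apply: nearW => n; have := tail n [::] J.
rewrite /= => h; have : fine (mn n (cylinder [::])) <= C0.
  by rewrite cylinder_nil -lee_fin -fineE//.
rewrite h; apply: le_trans.
by rewrite lerDl fine_ge0.
Qed.

Lemma limit_measure : exists m : {finite_measure set S -> \bar R},
  forall w, w <> [::] -> m (cylinder w) = (p w)%:E.
Proof.
(* The root receives the sum of its children instead of [p [::]], which may be strictly larger when
   mass escapes through the first symbol. *)
pose mu w := if w is [::] then limn (series (fun j => p [:: j])) else p w.
have mu_rcons w j : mu (rcons w j) = p (rcons w j) by case: w.
have cvr : cvgn (series (fun j => p [:: j])).
  apply: nondecreasing_is_cvgn.
    by apply/nondecreasing_seqP => n; rewrite /series/= big_nat_recr//= lerDl.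
  by exists C0 => _ [J _ <-]; exact: sum_root_le.
have [||w|m mE] := @cylinder_measure R mu _ _ A.
- case=> [|i w] /=; last exact: p_ge0.
  by apply: limr_ge => //; apply: nearW => n; exact: sumr_ge0.
- move=> [|i w]; first exact: cvr.
  have := @weights_children (i :: w).
  by apply.
- case: w => [|i w] /= w0.
    have : @cylinder A [::] point by rewrite cylinder_nil.
    by rewrite w0.
  have := mn_cvg (w := i :: w); rewrite w0 => h.
  by rewrite -(cvg_lim _ h)//; under eq_fun do rewrite measure0; rewrite lim_cst.
- by exists m => -[//|i w] _; exact: mE.
Qed.

(* Fatou's lemma gives [m (sigma^-1 C) <= m C] for cylinders; since the total masses
   agree, equality propagates from each cylinder to its children. *)
Lemma limit_invariant (m : {finite_measure set S -> \bar R}) :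
  (forall w, w <> [::] -> m (cylinder w) = (p w)%:E) ->
  forall C : set S, measurable C -> m (sigma @^-1` C) = m C.
Proof.
move=> mE.
have [k kE] := pushforward_measure m (@measurable_sigma A).
have kfin (C : set S) : measurable C -> k C \is a fin_num.
  move=> mC; rewrite kE fin_num_measure//.
  by rewrite -[X in measurable X]setTI; exact: measurable_sigma.
have mfin (C : set S) : measurable C -> m C \is a fin_num by move=> mC; rewrite fin_num_measure.
have pre w : sigma @^-1` cylinder w = \bigcup_j (cylinder (j :: w) : set S).
  apply/seteqP; split=> [x wx|x [j _ jx]].
    by exists (val x 0%N) => // -[//|i] /= iw; exact: wx.
  by move=> i iw; exact: (jx i.+1).
have tpre w : trivIset setT (fun j => cylinder (j :: w) : set S).
  by move=> i j _ _ [x [xi xj]]; move: (xi 0%N isT) (xj 0%N isT) => /= <- <-.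
have sub w : w <> [::] -> (k (cylinder w) <= m (cylinder w))%E.
  move=> w0; rewrite kE pre measure_bigcup//= mE//; apply: lime_le.
    by apply: is_cvg_nneseries => j _ _; exact: measure_ge0.
  apply: nearW => J; rewrite big_mkcond/=.
  rewrite (eq_bigr (fun j => (p (j :: w))%:E)); last first.
    by move=> j _; rewrite in_setT mE.
  rewrite sumEFin lee_fin.
  apply: (ler_cvg_to (@sum_weights_cvg (fun j => j :: w) J) (mn_cvg (w := w))).
  apply: nearW => n; rewrite -lee_fin -sumEFin -fineE// -(mn_inv n (mcyl w)) pre.
  rewrite measure_bigcup//= (eq_bigr (fun j => mn n (cylinder (j :: w)))); last first.
    by move=> j _; rewrite -fineE.
  rewrite (eq_eseriesl (Q := xpredT)); last by move=> j; rewrite in_setT.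
  by apply: nneseries_lim_ge => j _ _; exact: measure_ge0.
have keq w : k (cylinder w) = m (cylinder w).
  elim/last_ind: w => [|w j IH]; first by rewrite kE cylinder_nil preimage_setT.
  apply/eqP; rewrite eq_le sub/=; last by case: (w).
  pose F i : set S := if i == j then set0 else cylinder (rcons w i).
  have mF i : measurable (F i) by rewrite /F; case: ifP.
  have mUF : measurable (\bigcup_i F i) by exact: bigcupT_measurable.
  have tF : trivIset setT F.
    apply/trivIsetP => i i' _ _ ii'; rewrite /F; case: ifP => _; first by rewrite set0I.
    case: ifP => _; first by rewrite setI0.
    have /trivIsetP := @trivIset_cylinder A w; exact.
  have dec : cylinder w = cylinder (rcons w j) `|` \bigcup_i F i :> set S.
    rewrite cylinder_split; apply/seteqP; split=> x.
      move=> [i _ ix]; case: (eqVneq i j) => [<-|ij]; first by left.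
      by right; exists i => //; rewrite /F (negbTE ij).
    move=> [jx|[i _]]; first by exists j.
    by rewrite /F; case: ifP => // _ ix; exists i.
  have dis : cylinder (rcons w j) `&` \bigcup_i F i = set0 :> set S.
    apply/seteqP; split=> // x [/cylinder_rcons[_ xj] [i _]].
    by rewrite /F; case: eqP => // ij /cylinder_rcons[_ xi]; apply: ij; rewrite -xi.
  have kd : k (cylinder w) = (k (cylinder (rcons w j)) + k (\bigcup_i F i))%E.
    by rewrite dec measureU.
  have md : m (cylinder w) = (m (cylinder (rcons w j)) + m (\bigcup_i F i))%E.
    by rewrite dec measureU.
  have le : (k (\bigcup_i F i) <= m (\bigcup_i F i))%E.
    rewrite !measure_bigcup//; apply: lee_nneseries => [i _ _|i _]; first exact: measure_ge0.
    rewrite /F; case: ifP => _; first by rewrite !measure0.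
    by apply: sub; case: (w).
  move: IH; rewrite kd md => E.
  have f1 := kfin _ (mcyl (rcons w j)); have f2 := mfin _ (mcyl (rcons w j)).
  have f3 := kfin _ mUF; have f4 := mfin _ mUF.
  move: E le; rewrite -(fineK f1) -(fineK f2) -(fineK f3) -(fineK f4) -!EFinD !lee_fin.
  by move=> [] ? ?; lra.
move=> C mC; rewrite -kE; apply/esym.
(* Two cylinders are nested or disjoint, so adjoining the empty set gives a family closed under
   intersection. *)
pose G : set (set S) := set0 |` range (@cylinder A).
have GE : @measurable _ S = <<s G >>.
  apply/seteqP; split.
    apply: smallest_sub; first exact: smallest_sigma_algebra.
    by move=> C' C'cyl; apply: sub_sigma_algebra; right.
  apply: smallest_sub; first exact: smallest_sigma_algebra.
  move=> _ [->|[w _ <-]]; first exact: measurable0.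
  exact: measurable_cylinder.
have GI : setI_closed G.
  move=> _ _ [->|[w _ <-]] [->|[w' _ <-]]; rewrite ?set0I ?setI0; try by left.
  wlog ww' : w w' / (size w <= size w')%N.
    move=> W; have [/W//|/ltnW /W] := leqP (size w) (size w').
    by rewrite setIC.
  have [E|E] := eqVneq (take (size w) w') w.
    right; exists w' => //; apply/seteqP; split=> x; last by case.
    move=> w'x; split=> // i iw; rewrite w'x ?(leq_trans iw)//.
    by rewrite -[in RHS]E nth_take.
  left; apply/seteqP; split=> // x [wx w'x].
  case/eqP: E; apply: (@eq_from_nth _ 0%N); rewrite size_takel// => i iw.
  by rewrite nth_take// -wx// -w'x// (leq_trans iw).
apply: (measure_unique G (fun=> setT)) => //.
- by move=> _; right; exists [::] => //; rewrite cylinder_nil.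
- by apply/seteqP; split=> // x _; exists 0%N.
- by move=> _ [->|[w _ <-]]; [rewrite !measure0|rewrite keq].
- by move=> _; rewrite ltey_eq mfin.
Qed.

End LimitMeasure.

Section SubProbabilityOf.
Context d (T : measurableType d) (R : realType).
Variables (m : {measure set T -> \bar R}) (m1 : (m setT <= 1)%E).

Definition subprobability_fun : set T -> \bar R := let _ := m1 in m.

HB.instance Definition _ := Measure.copy subprobability_fun m.

HB.instance Definition _ :=
  Measure_isSubProbability.Build _ _ _ subprobability_fun m1.

End SubProbabilityOf.

Lemma subprobability_of d (T : measurableType d) (R : realType)
    (m : {measure set T -> \bar R}) : (m setT <= 1)%E ->
  exists m' : subprobability T R, forall A, m' A = m A.
Proof. by move=> m1; exists (subprobability_fun m1). Qed.

Lemma limn_einf_gt_lower (R : realType) (u : nat -> \bar R) :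
  (-oo < limn_einf u)%E -> exists N (r : R), forall n, (N <= n)%N -> (r%:E <= u n)%E.
Proof.
rewrite limn_einf_lim (cvg_lim _ (@cvg_einfs_sup _ u))//.
move=> /ereal_sup_gt[_ [N _ <-]] lt.
have [r rN] : exists r : R, (r%:E <= einfs u N)%E.
  move: lt; case: (einfs u N) => [r _|_|//]; first by exists r.
  by exists 0; rewrite leey.
exists N, r => n Nn; apply: (le_trans rN); apply: ereal_inf_lbound.
by exists n.
Qed.

(** * Uniform tightness from the bound on the integrals *)

Section Cost.
Variables (A : transition) (R : realType) (tau : roof A R).
Variables (f : suspension tau -> R) (f_cont : continuous f).
Local Notation sigma := (@sigma A).
Local Notation S := (cyl_space A).
Local Notation Y := (borel_suspension tau).
Local Notation lam := (@lebesgue_measure R).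

Lemma mass_le_integral (m : {finite_measure set S -> \bar R}) (nu : {measure set Y -> \bar R}) (c : R) :
  0 < c -> (forall x, c <= tau x) ->
  (forall B : set Y, measurable B -> nu B = (m \x lam)%E (Y0 tau `&` pt tau @^-1` B)) ->
  (nu setT <= 1)%E -> (m setT <= (c^-1)%:E)%E.
Proof.
move=> c0 ctau nuE nu1.
have mI : measurable (`[0, c[%classic : set (measurableTypeR R)) by exact: measurable_itv.
have E : (m \x lam)%E (setT `*` `[0, c[%classic) = (m setT * c%:E)%E.
  transitivity (m setT * lam `[0%R, c[%classic)%E; first exact: product_measure1E.
  by rewrite lebesgue_measure_itv/= lte_fin c0 oppr0 adde0.
have : (m setT * c%:E <= 1)%E.
  rewrite -E; apply: le_trans nu1; rewrite nuE// preimage_setT setIT.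
  apply: le_measure; rewrite ?inE; [exact: measurableX|exact: measurable_Y0|].
  move=> [x t] [_] /=; rewrite in_itv/= /Y0/= => /andP[-> tc].
  exact: lt_le_trans (ctau x).
have mfin : m setT \is a fin_num by rewrite fin_num_measure.
by rewrite -(fineK mfin) -EFinM !lee_fin -ler_pdivlMr// div1r.
Qed.

Variables (M : R) (fM : forall y, f y <= M - 1) (M1 : 1 <= M).

(* The integral of [M - f] over the fiber of [x]. *)
Let G (x : Sigma A) := M * tau x - Delta f x.

Let Mf_ge0 y : 0 <= M - f y.
Proof. by have := fM y; lra. Qed.

Lemma cost_ge_roof x : tau x <= M * tau x - Delta f x.
Proof.
have : (0 <= fiber_integral (fun y : suspension tau => ((M - 1) - f y)%R) x)%E.
  by apply: integral_ge0 => t _; rewrite lee_fin subr_ge0.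
by rewrite (fiber_integral_subr f_cont) lee_fin; lra.
Qed.

Let G_ge0 x : 0 <= G x.
Proof. by apply: le_trans (cost_ge_roof x); rewrite ltW// roof_gt0. Qed.

Let measurable_Mf : measurable_fun setT ((fun y => M - f y) : Y -> R).
Proof.
apply: measurable_funB; first exact: measurable_cst.
exact: continuous_measurable_susp.
Qed.

Let measurable_G : measurable_fun setT (G : S -> R).
Proof.
apply/measurable_EFinP.
have := measurable_fiber_integral measurable_Mf Mf_ge0.
by congr (measurable_fun _ _); apply/funext => x /=; rewrite (fiber_integral_subr f_cont).
Qed.

(** The bound is [M + M - r] because [M - f] is majorized by [M] plus the negative part of [f],
    whose integral is at most that of the positive part minus [r], hence at most [M - r]. All
    integrals used are those of nonnegative functions. *)
Lemma cost_integral_le (m : {finite_measure set S -> \bar R}) (nu : probability Y R) (r : R) :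
  (forall B : set Y, measurable B -> nu B = (m \x lam)%E (Y0 tau `&` pt tau @^-1` B)) ->
  (r%:E <= \int[nu]_y (f y)%:E)%E ->
  (\int[m]_x (G x)%:E <= (M + M - r)%:E)%E.
Proof.
move=> nuE rf.
have mf : measurable_fun setT (fun y : Y => (f y)%:E).
  by apply/measurable_EFinP; exact: continuous_measurable_susp.
have -> : (\int[m]_x (G x)%:E = \int[nu]_y (M - f y)%:E)%E.
  rewrite (integral_base nuE measurable_Mf Mf_ge0); apply: eq_integral => x _.
  by rewrite (fiber_integral_subr f_cont).
set fp := (fun y : Y => (f y)%:E)^\+%E; set fn := (fun y : Y => (f y)%:E)^\-%E.
have mfp : measurable_fun setT fp by exact: measurable_funepos.
have mfn : measurable_fun setT fn by exact: measurable_funeneg.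
have intM : (\int[nu]_y (cst M%:E) y)%E = M%:E.
  rewrite integral_cst// -[RHS]mule1; congr (_ * _)%E; exact: probability_setT.
have fpM : (\int[nu]_y fp y <= M%:E)%E.
  rewrite -intM; apply: ge0_le_integral => //.
  - by move=> y _; exact: funepos_ge0.
  - move=> y _; rewrite /fp funeposE ge_max !lee_fin.
    by rewrite (le_trans (fM y)) ?gerBl// (le_trans ler01).
have fp0 : (0 <= \int[nu]_y fp y)%E by apply: integral_ge0 => y _; exact: funepos_ge0.
have fn0 : (0 <= \int[nu]_y fn y)%E by apply: integral_ge0 => y _; exact: funeneg_ge0.
have fnM : (\int[nu]_y fn y <= (M - r)%:E)%E.
  move: rf; rewrite integralE -/fp -/fn.
  move: fpM fp0 fn0; case: (\int[nu]_y fp y)%E => [a| |]//; case: (\int[nu]_y fn y)%E => [b| |]//.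
  by rewrite !lee_fin; lra.
apply: (@le_trans _ _ (\int[nu]_y (M%:E + fn y))%E).
  apply: ge0_le_integral => //.
  - by move=> y _; rewrite lee_fin.
  - exact/measurable_EFinP.
  - by apply: emeasurable_funD => //; exact: measurable_cst.
  - move=> y _; rewrite EFinB leeD2l// /fn funenegE le_max; apply/orP; left.
    by [].
have MfnE : (\int[nu]_y (M%:E + fn y) = M%:E + \int[nu]_y fn y)%E.
  rewrite -[X in (_ = X + _)%E]intM; apply: ge0_integralD => //.
  - by move=> y _; rewrite lee_fin (le_trans ler01).
  - by move=> y _; exact: funeneg_ge0.
by rewrite MfnE -addrA EFinD leeD2l.
Qed.

Variables (tau_var : summable_variations tau).
Variables (Df_var : summable_variations (Delta f)).

Lemma fan_tight a d1 d2 (C0 K : R) i e :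
  0 < d1 -> 0 <= d2 -> (pressure a d1 d2 f < +oo)%E -> 0 <= K -> 0 < e ->
  exists J, forall m : {finite_measure set S -> \bar R},
    (forall C : set S, measurable C -> m (sigma @^-1` C) = m C) ->
    (m setT <= C0%:E)%E -> (\int[m]_x (G x)%:E <= K%:E)%E ->
    fine (m (fan i J)) <= e.
Proof.
move=> d10 d20 Poo K0 e0.
have M0 : 0 <= M by exact: le_trans ler01 M1.
(* With [2 * K < N * e] and [2 * C0 < L * e], each of the two terms in [visit_bound] is less than
   half of [N * L * e], so the fan cannot have mass above [e]. *)
pose N := 2 * K / e + 1.
have N0 : 0 < N by rewrite ltr_wpDl// divr_ge0 ?mulr_ge0// ltW.
have [J JP] := loop_cost f_cont tau_var Df_var M0 cost_ge_roof i N d10 d20 Poo.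
exists J => m m_inv mC0 GK.
have loopN x r : fan i J x -> (0 < r)%N -> fan i J (iter r sigma x) -> N <= bsum G r x.
  move=> [xi xJ] r0 [ri _]; apply/ltW/JP => //.
  by rewrite -ri iter_sigmaE addn0.
rewrite leNgt; apply/negP; set q := fine _ => eq'.
pose L := (Num.truncn (2 * C0 / e)).+1.
have L0 : 0 < L%:R :> R by rewrite ltr0n.
have hL : 2 * C0 / e < L%:R by exact: truncnS_gt.
have := @visit_bound A R m m_inv G (fan i J) N K C0 L measurable_G G_ge0
  (measurable_fan i J) (ltW N0) loopN GK mC0.
rewrite -/q => h.
have hN : 2 * K < N * e.
  by rewrite -ltr_pdivrMr// /N ltrDl.
rewrite ltr_pdivrMr// in hL.
have h1 : L%:R * (2 * K) < L%:R * (N * e) by rewrite ltr_pM2l.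
have h2 : N * (2 * C0) < N * (L%:R * e) by rewrite ltr_pM2l.
have h3 : N * L%:R * e < N * L%:R * q by rewrite ltr_pM2l// mulr_gt0.
have E1 : L%:R * (N * e) = N * L%:R * e by ring.
have E2 : N * (L%:R * e) = N * L%:R * e by ring.
lra.
Qed.

End Cost.

(** Otherwise every variation would be at least [e] and their sum would diverge. *)
Lemma uniformly_continuous_variations (A : transition) (R : realType)
    (phi : Sigma A -> R) (e : R) : summable_variations phi -> 0 < e ->
  exists k, forall x y, agree k x y -> `|phi x - phi y| <= e.
Proof.
move=> sv e0; pose s : \bar R := (\sum_(2 <= n <oo) Defs.variation n phi)%E.
have s0 : (0 <= s)%E by apply: nneseries_ge0 => k _ _; exact: shift_variation_ge0.
have sfin : s \is a fin_num by rewrite ge0_fin_numE.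
apply: contrapT => /forallNP no.
have ve k : (e%:E <= Defs.variation k phi)%E.
  have /existsNP[x /existsNP[y /not_implyP[xy /negP]]] := no k.
  rewrite -ltNge => h; apply: le_trans (shift_variation_ge phi xy).
  by rewrite lee_fin ltW.
pose L := (Num.truncn (fine s / e)).+1.
have hL : fine s < e *+ L.
  by rewrite -mulr_natl -ltr_pdivrMr//; exact: truncnS_gt.
have : ((e *+ L)%:E <= s)%E.
  apply: (@le_trans _ _ (\sum_(2 <= k < L.+2) Defs.variation k phi)%E); last first.
    by apply: nneseries_lim_ge => k _ _; exact: shift_variation_ge0.
  apply: (@le_trans _ _ (\sum_(2 <= k < L.+2) e%:E)%E).
    by rewrite sumEFin sumr_const_nat !subSS subn0.
  by apply: lee_sum => k _; exact: ve.
by rewrite -(fineK sfin) lee_fin leNgt hL.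
Qed.

(** * Extraction of the subsequence and of its limit *)

Theorem theorem4p5 (R : realType) (A : transition) (tau : roof A R)
    (tau_var : summable_variations tau)
    (f : suspension tau -> R) (f_cont : continuous f)
    (f_sup : has_ubound (range f))
    (Df_var : summable_variations (Delta f))
    (a : nat) (d1 d2 : R) (d1_gt0 : 0 < d1) (d2_ge0 : 0 <= d2)
    (f_pressure : (pressure a d1 d2 f < +oo)%E)
    (nu : nat -> probability (borel_suspension tau) R)
    (nu_inv : forall n, flow_invariant (nu n))
    (nu_f : (-oo < limn_einf (fun n => \int[nu n]_y (f y)%:E))%E) :
  exists k : nat -> nat, {homo k : m n / (m < n)%N} /\
    exists nu' : subprobability (borel_suspension tau) R,
      flow_invariant nu' /\ converges_on_cylinders (fun n => nu (k n)) nu'.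
Proof.
have [c c0 ctau] := roof_bounded_away tau.
have [B0 fB0] := f_sup.
(* The maximum with 0 ensures [1 <= M] even for negative [f], and the added 1 is the margin which
   makes the cost dominate [tau]. *)
pose M := Num.max B0 0 + 1.
have fM y : f y <= M - 1.
  by rewrite /M addrK le_max fB0//; exists y.
have M1 : 1 <= M by rewrite /M lerDr le_max lexx orbT.
have [N0 [r rP]] := limn_einf_gt_lower nu_f.
(* The lower limit bounds the integrals only from [N0] on, so the sequence is shifted; the final
   subsequence adds [N0] back. *)
have /choice[mu0 mu0E] := fun n => disintegration (nu_inv (n + N0)%N).
have mu0_inv n (C : set (cyl_space A)) : measurable C -> mu0 n (@sigma A @^-1` C) = mu0 n C.
  by move=> mC; apply: (base_invariant (mu0E n)) => //; exact: nu_inv.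
have mu0_mass n : (mu0 n setT <= (c^-1)%:E)%E.
  by apply: (mass_le_integral c0 ctau (mu0E n)); exact: probability_le1.
have mu0_cost n : (\int[mu0 n]_x (M * tau x - Delta f x)%:E <= (M + M - r)%:E)%E.
  by apply: (cost_integral_le f_cont fM M1 (mu0E n)); apply: rP; exact: leq_addl.
have K0 : 0 <= M + M - r.
  rewrite -lee_fin; apply: le_trans (mu0_cost 0%N); apply: integral_ge0 => x _.
  by rewrite lee_fin; apply: le_trans (cost_ge_roof f_cont fM x); rewrite ltW// roof_gt0.
have mcyl w : measurable (cylinder w : set (cyl_space A)) by exact: measurable_cylinder.
have mu0_le n (C : set (cyl_space A)) : measurable C -> fine (mu0 n C) <= c^-1.
  move=> mC; rewrite -lee_fin fineK ?fin_num_measure//; apply: le_trans (mu0_mass n).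
  by apply: le_measure; rewrite ?inE.
have wB n w : 0 <= fine (mu0 n (cylinder w)) <= c^-1.
  by rewrite fine_ge0//= mu0_le.
have [k0 [k0_homo [p k0_cvg]]] := pointwise_subsequence wB.
have tight i (e : R) : 0 < e -> exists J, forall n, fine (mu0 (k0 n) (fan i J)) <= e.
  move=> e0; have [J JP] := @fan_tight A R tau f f_cont M fM M1 tau_var Df_var
    a d1 d2 c^-1 (M + M - r) i e d1_gt0 d2_ge0 f_pressure K0 e0.
  by exists J => n; apply: (JP (mu0 (k0 n)) _ (mu0_mass _) (mu0_cost _)); exact: mu0_inv.
have [m mE] := limit_measure (fun n => mu0_inv (k0 n)) k0_cvg tight (fun n => mu0_mass (k0 n)).
have m_inv := limit_invariant (fun n => mu0_inv (k0 n)) k0_cvg mE.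
have [nu1 nu1E'] := pushforward_measure
  (mrestr (m \x lebesgue_measure)%E (measurable_Y0 tau)) (@measurable_pt A R tau).
have nu1E (B : set (borel_suspension tau)) : measurable B ->
    nu1 B = (m \x lebesgue_measure)%E (Y0 tau `&` pt tau @^-1` B).
  by move=> _; rewrite nu1E' /mrestr setIC.
have box_int (nu2 : {measure set (borel_suspension tau) -> \bar R})
    (m2 : {finite_measure set (cyl_space A) -> \bar R}) w s t :
    (forall B : set (borel_suspension tau), measurable B ->
      nu2 B = (m2 \x lebesgue_measure)%E (Y0 tau `&` pt tau @^-1` B)) ->
    nu2 (box (cylinder w) s t) = (cyl_int m2 (clip tau s t) w)%:E.
  move=> nu2E; rewrite (measure_box nu2E).
  apply: (cyl_intE _ _ (measurable_clip tau s t) (B := Num.max 0 t)) => x.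
  by rewrite clip_ge0 clip_le.
have cyl_cvg w : w <> [::] ->
    fine (mu0 (k0 n) (cylinder w)) @[n --> \oo] --> fine (m (cylinder w)).
  by move=> w0; rewrite mE//; exact: k0_cvg.
have int_cvg w s t : w <> [::] ->
    cyl_int (mu0 (k0 n)) (clip tau s t) w @[n --> \oo] --> cyl_int m (clip tau s t) w.
  apply: (@cyl_int_cvg A R (fun n => mu0 (k0 n)) m c^-1 cyl_cvg _ _ (Num.max 0 t)).
  - by move=> n w'; exact: mu0_le.
  - exact: measurable_clip.
  - by move=> x; rewrite clip_ge0 clip_le.
  - move=> e e0; have [k kP] := uniformly_continuous_variations tau_var e0.
    by exists k => x y /kP; apply: le_trans (clip_lipschitz _ _ _ _ _).
(* Convergence is known only over nonempty words, so the total mass is not a limit of total masses.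
   The space is exhausted by boxes of height [n], each split by first symbols; every finite partial
   sum is a limit of quantities at most 1. *)
have nu1_le1 : (nu1 setT <= 1)%E.
  pose F (n : nat) : set (borel_suspension tau) := box (cylinder [::]) 0 n%:R.
  have mF n : measurable (F n).
    rewrite /F box_coords -[X in measurable X]setTI.
    apply: (@measurable_coords A R tau measurableT (cylinder [::] `*` `[0, n%:R])).
    by apply: measurableX; [exact: measurable_cylinder|exact: measurable_itv].
  have FP n y : F n y <-> (coords y).2 <= n%:R.
    rewrite /F box_coords /= in_itv/=; have /andP[-> _] := coords_Y0 y.
    by split => [[]//|h]; split.
  have FT : \bigcup_n F n = setT.
    apply/seteqP; split => // y _; exists (Num.truncn (coords y).2).+1 => //.
    by apply/FP/ltW; exact: truncnS_gt.
  have Fhomo : nondecreasing_seq F.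
    move=> i j ij; apply/subsetPset => y /FP h; apply/FP; apply: (le_trans h).
    by rewrite ler_nat.
  have : nu1 \o F @ \oo --> nu1 setT.
    by rewrite -FT; apply: nondecreasing_cvg_mu => //; rewrite FT.
  move=> Fcvg; rewrite -(cvg_lim _ Fcvg)//; apply: lime_le; first by apply/cvg_ex; exists (nu1 setT).
  apply: nearW => n; rewrite /F /= (box_int nu1 m)// lee_fin.
  pose h := clip tau 0 n%:R.
  have hB (x : cyl_space A) : 0 <= h x <= Num.max 0 n%:R by rewrite clip_ge0 clip_le.
  have mh := measurable_clip tau 0 n%:R.
  have ch := @cyl_int_children A R m h [::] _ mh hB.
  rewrite -(cvg_lim _ ch)//; apply: limr_le; first by apply/cvg_ex; exists (cyl_int m h [::]).
  apply: nearW => J; rewrite /series /=.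
  have cJ : \sum_(0 <= j < J) cyl_int (mu0 (k0 l)) h [:: j] @[l --> \oo] -->
      \sum_(0 <= j < J) cyl_int m h [:: j].
    elim: J => [|K IHK].
      by under eq_fun do rewrite big_geq//; rewrite big_geq//; exact: cvg_cst.
    under eq_fun do rewrite big_nat_recr//=.
    by rewrite big_nat_recr//=; apply: cvgD => //; exact: int_cvg.
  rewrite -(cvg_lim _ cJ)//; apply: limr_le; first by apply/cvg_ex; eexists; exact: cJ.
  apply: nearW => l; apply: (le_trans (@cyl_int_partial A R (mu0 (k0 l)) h [::] _ J mh hB)).
  rewrite -lee_fin -(box_int _ (mu0 (k0 l)) _ _ _ (mu0E (k0 l))).
  exact: (probability_le1 _ (mF n)).
have [nu' nu'E] := subprobability_of nu1_le1.
exists (fun n => k0 n + N0)%N; split.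
  by move=> i j ij; rewrite ltn_add2r k0_homo.
exists nu'; split.
  move=> t t0 B mB; rewrite !nu'E.
  exact: (suspension_invariant nu1E m_inv).
move=> w s t w0; rewrite nu'E (box_int nu1 m)//.
rewrite (_ : (fun n => _) =
  fun n => (cyl_int (mu0 (k0 n)) (clip tau s t) w)%:E); last first.
  by apply/funext => n; exact: (box_int _ _ _ _ _ (mu0E (k0 n))).
by apply: cvg_EFin; [exact: nearW|exact: int_cvg].
Qed.
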